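(* Let $k$ be a positive integer and let $z\in\mathbb{C}$ with $\Re(z)\ge 0$ and $z\ne 0$. Then $$\left|\frac{\widehat{R}_{k+1}(z)}{\widehat{T}_k(z)}\right| \le \eta_k\,\frac{\pi^{1/2}\,\Gamma(k+\frac12)}{\Gamma(k)}.$$
   Context: $\log$ is the principal branch of the logarithm on $\mathbb{C}\setminus(-\infty,0]$. $\ln\Gamma$ denotes the analytic function on $\mathbb{C}\setminus(-\infty,0]$ with $\exp(\ln\Gamma(z))=\Gamma(z)$ that is real and equal to $\log(\Gamma(x))$ for real $x>0$. $B_{2j}(u)$ is the Bernoulli polynomial and $B_{2j}=B_{2j}(0)$ the Bernoulli number. For integers $k\ge1$, $\eta_k = 1/(1-2^{1-2k})$. For integers $j\ge 1$, $$\widehat{T}_j(z) = \frac{B_{2j}(\frac12)}{2j(2j-1)z^{2j-1}} = -\frac{(1-2^{1-2j})B_{2j}}{2j(2j-1)z^{2j-1}},$$ and for integers $k\ge 1$ the remainder $\widehat{R}_k(z)$ is defined by $$\ln\Gamma(z+\tfrac12) = z\log z - z + \tfrac12\log(2\pi) + \sum_{j=1}^{k-1}\widehat{T}_j(z) + \widehat{R}_k(z).$$ *)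

(* Defs.v *)
From Stdlib Require Import Reals Lra Lia Arith ZArith.
From Coquelicot Require Import Coquelicot.

Open Scope R_scope.

(* [C] is Coquelicot's type of complex numbers; the binomial
   coefficient is written [Binomial.C]. *)

Definition Cexp (z : C) : C := (exp (Re z) * cos (Im z), exp (Re z) * sin (Im z)).

(* Principal argument, with values in (-PI, PI] for z <> 0. *)
Definition Carg (z : C) : R :=
  if Rle_dec 0 (Im z) then acos (Re z / Cmod z) else - acos (Re z / Cmod z).

Definition Clog (z : C) : C := (ln (Cmod z), Carg z).

Fixpoint rising (z : C) (n : nat) : C :=
  match n with
  | O => RtoC 1
  | S m => (rising z m * (z + RtoC (INR m)))%C
  end.

(* Euler-Gauss definition:
     Gamma z = lim_n  n! n^z / (z (z+1) ... (z+n)),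
   for z not a nonpositive integer (the value there is irrelevant).  The limit
   in C is taken componentwise. *)
Definition Gamma_approx (z : C) (n : nat) : C :=
  (RtoC (INR (fact n)) * Cexp (z * RtoC (ln (INR n))) / rising z (S n))%C.

Definition Gamma (z : C) : C :=
  (real (Lim_seq (fun n => Re (Gamma_approx z n))),
   real (Lim_seq (fun n => Im (Gamma_approx z n)))).

(* Gamma is real on the real axis. *)
Definition RGamma (x : R) : R := Re (Gamma (RtoC x)).

(* The complex plane cut along the closed negative real half-line. *)
Definition cut_plane (z : C) : Prop := ~ (Re z <= 0 /\ Im z = 0).

(* [f] is the function ln Gamma on the cut plane; analyticity on this open set
   is complex differentiability at each of its points. *)
Definition is_lnGamma (f : C -> C) : Prop :=
  (forall z : C, cut_plane z ->
     @ex_derive C_AbsRing C_NormedModule f z) /\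
  (forall z : C, cut_plane z -> Cexp (f z) = Gamma z) /\
  (forall x : R, 0 < x -> f (RtoC x) = RtoC (ln (RGamma x))).

(* [bernoulli_upto n j] is the Bernoulli number B_j for all j <= n, computed by
   course-of-values recursion; see [bernoulli_0] and [bernoulli_rec]. *)
Fixpoint bernoulli_upto (n : nat) : nat -> R :=
  match n with
  | O => fun _ => 1
  | S m => fun j =>
      if Nat.eqb j (S m) then
        - sum_f_R0 (fun i => Binomial.C (m + 2) i * bernoulli_upto m i) m
          / INR (m + 2)
      else bernoulli_upto m j
  end.

Definition bernoulli (n : nat) : R := bernoulli_upto n n.

Lemma bernoulli_0 : bernoulli 0 = 1.
Proof. reflexivity. Qed.

Lemma bernoulli_upto_eq (n j : nat) : (j <= n)%nat -> bernoulli_upto n j = bernoulli j.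
Proof.
induction n as [|n IH]; intros Hj.
- replace j with 0%nat by lia; reflexivity.
- destruct (Nat.eq_dec j (S n)) as [->|Hne]; [reflexivity|].
  simpl; rewrite (proj2 (Nat.eqb_neq _ _) Hne); apply IH; lia.
Qed.

Lemma bernoulli_rec (n : nat) : (1 <= n)%nat ->
  sum_f_R0 (fun i => Binomial.C (n + 1) i * bernoulli i) n = 0.
Proof.
destruct n as [|m]; [lia|intros _].
replace (S m + 1)%nat with (m + 2)%nat by lia.
rewrite tech5.
assert (HB : bernoulli (S m) =
  - sum_f_R0 (fun i => Binomial.C (m + 2) i * bernoulli i) m / INR (m + 2)).
{ unfold bernoulli at 1; simpl bernoulli_upto; rewrite Nat.eqb_refl.
  do 2 f_equal; apply sum_eq; intros i Hi; now rewrite bernoulli_upto_eq. }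
assert (HC : Binomial.C (m + 2) (S m) = INR (m + 2)).
{ replace (m + 2)%nat with (S (S m)) by lia.
  rewrite pascal_step1 by lia.
  replace (S (S m) - S m)%nat with 1%nat by lia.
  unfold Binomial.C; replace (S (S m) - 1)%nat with (S m) by lia.
  rewrite (fact_simpl (S m)), mult_INR; simpl (fact 1); simpl (INR 1).
  field; apply INR_fact_neq_0. }
rewrite HB, HC; field; apply not_0_INR; lia.
Qed.

Definition bernoulli_poly (n : nat) (u : R) : R :=
  sum_f_R0 (fun i => Binomial.C n i * bernoulli i * u ^ (n - i)) n.

Definition eta (k : nat) : R := 1 / (1 - powerRZ 2 (1 - 2 * Z.of_nat k)).

(* For j >= 1, so that the natural number 2 j - 1 is not truncated. *)
Definition T_hat (j : nat) (z : C) : C :=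
  (RtoC (bernoulli_poly (2 * j) (1 / 2))
   / (RtoC (INR (2 * j)) * RtoC (INR (2 * j - 1)) * z ^ (2 * j - 1)))%C.

(* The sum over 1 <= j <= k - 1 is empty, equal to 0, for k = 1. *)
Definition R_hat (lnGamma : C -> C) (k : nat) (z : C) : C :=
  (lnGamma (z + RtoC (1 / 2))
   - (z * Clog z - z + RtoC (1 / 2 * ln (2 * PI))
      + sum_n_m (fun j => T_hat j z) 1 (k - 1)))%C.

(* Main.v *)
Require Import Defs.
From Stdlib Require Import Reals Lra Lia Arith.
From Coquelicot Require Import Coquelicot.

(** Apply the Euler-Maclaurin formula with midpoints to the logarithm on [[0, n]], shifted
    by [z]. The sum of [log (z + j + 1/2)] over [j < n] is then the difference of
    Stirling's series [z log z - z + T_1 + .. + T_k] between [z + n] and [z], up to an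
    error [e_n]. Up to sign this error is the integral over [[0, n]] of
    [B_2k(x) / (2k) / (z + u) ^ (2k)], where [x] is the fractional part of [u + 1/2].
    Now [|B_2k(x)| <= |B_2k|] on [[0, 1]], and [|z + u| ^ 2 >= |z| ^ 2 + u ^ 2] because
    [Re z >= 0], so
    [|e_n| <= |B_2k| / (2k) * int_0^oo du / (|z| ^ 2 + u ^ 2) ^ k].
    This integral is [|z| ^ (1 - 2k)] times a Wallis integral, which is a ratio of gamma
    values, and [B_2k(1/2) = - (1 - 2 ^ (1 - 2k)) B_2k] brings in [eta k] when one divides
    by [T_k].

    The error is not written as an integral: [euler_maclaurin] is an explicit
    antiderivative of the error term on each half of a unit interval, and [Cmod_increment_le] bounds the increment of a
    complex function by that of a real function that majorizes its derivative. This gives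
    [stirling_main_step], and after summation [stirling_error_lim]. The facts on Bernoulli
    polynomials are [bernoulli_poly_even_bound] and [bernoulli_poly_half].

    To return to the gamma function, take logarithms in the Euler-Gauss product. The limit
    exists and is Stirling's series plus a constant minus the limit of [e_n]
    ([lnGamma_approx_lim]); the constant [1/2 ln (2 PI)] comes from Wallis' product, which
    also gives [Gamma (1/2)]. This limit and the given [ln Gamma] have the same
    exponential. Their difference is thus a multiple of [2 i PI]; it is continuous along a
    path from the positive real axis, where it vanishes, so it is zero
    ([lnGamma_eq_lim]). *)

(** * Bernoulli polynomials *)

Lemma is_derive_sum_f_R0 (f : nat -> R -> R) (df : nat -> R) (n : nat) (x : R) :
  (forall i, (i <= n)%nat -> is_derive (f i) x (df i)) ->
  is_derive (fun y => sum_f_R0 (fun i => f i y) n) x (sum_f_R0 df n).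
Proof.
  intros H.
  apply (is_derive_ext (fun y => sum_n (fun i => f i y) n)).
  { intros y; apply sum_n_Reals. }
  rewrite <- sum_n_Reals.
  exact (is_derive_sum_n (V := R_NormedModule) f n x df H).
Qed.

Lemma binomial_absorb (n i : nat) : (i <= n)%nat ->
  Binomial.C (S n) i * INR (S n - i) = INR (S n) * Binomial.C n i.
Proof.
  intros Hi; unfold Binomial.C.
  replace (S n - i)%nat with (S (n - i)) by lia.
  rewrite (fact_simpl n), (fact_simpl (n - i)), !mult_INR.
  field; repeat split; try apply INR_fact_neq_0; apply not_0_INR; lia.
Qed.

Lemma binomial_diag (n : nat) : Binomial.C n n = 1.
Proof.
  unfold Binomial.C; rewrite Nat.sub_diag; change (INR (fact 0)) with 1.
  field; apply INR_fact_neq_0.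
Qed.

Lemma bernoulli_poly_derive (n : nat) (x : R) :
  is_derive (bernoulli_poly (S n)) x (INR (S n) * bernoulli_poly n x).
Proof.
  unfold bernoulli_poly.
  replace (INR (S n) * _) with (sum_f_R0 (fun i => Binomial.C (S n) i * bernoulli i
     * (INR (S n - i) * x ^ pred (S n - i))) (S n)).
  - apply (is_derive_sum_f_R0
      (fun i u => Binomial.C (S n) i * bernoulli i * u ^ (S n - i))
      (fun i => Binomial.C (S n) i * bernoulli i
                  * (INR (S n - i) * x ^ pred (S n - i)))).
    intros i _; generalize (S n - i)%nat; intros m; auto_derive; [easy | ring].
  - rewrite tech5, Nat.sub_diag; simpl (INR 0).
    rewrite Rmult_0_l, Rmult_0_r, Rplus_0_r, scal_sum.
    apply sum_eq; intros i Hi.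
    replace (pred (S n - i)) with (n - i)%nat by lia.
    transitivity ((Binomial.C (S n) i * INR (S n - i)) * bernoulli i * x ^ (n - i));
      [ring | rewrite binomial_absorb by easy; ring].
Qed.

Lemma bernoulli_poly_0 (n : nat) : bernoulli_poly n 0 = bernoulli n.
Proof.
  unfold bernoulli_poly; destruct n as [|n].
  - simpl; unfold Binomial.C; simpl; field.
  - rewrite tech5, Nat.sub_diag, (sum_eq _ (fun _ => 0)), sum_cte.
    + rewrite binomial_diag, pow_O; ring.
    + intros i Hi; rewrite pow_i by lia; ring.
Qed.

Lemma bernoulli_poly_zeroth (x : R) : bernoulli_poly 0 x = 1.
Proof. unfold bernoulli_poly, Binomial.C; simpl; rewrite bernoulli_0; field. Qed.

Lemma bernoulli_poly_first (x : R) : bernoulli_poly 1 x = x - 1 / 2.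
Proof.
  assert (H := bernoulli_rec 1 (le_n 1)).
  unfold bernoulli_poly; unfold Binomial.C in *; simpl in *.
  rewrite bernoulli_0 in *; lra.
Qed.

Lemma bernoulli_poly_1 (n : nat) : (2 <= n)%nat ->
  bernoulli_poly n 1 = bernoulli_poly n 0.
Proof.
  intros Hn; rewrite bernoulli_poly_0; destruct n as [|n]; [lia|].
  assert (Hrec := bernoulli_rec n ltac:(lia)).
  unfold bernoulli_poly; rewrite tech5, Nat.sub_diag.
  rewrite (sum_eq _ (fun i => Binomial.C (n + 1) i * bernoulli i)), Hrec.
  - rewrite binomial_diag, pow_O; ring.
  - intros i Hi; rewrite pow1, Rmult_1_r; now replace (n + 1)%nat with (S n) by lia.
Qed.

Lemma constant_of_derive_0 (f : R -> R) :
  (forall x, is_derive f x 0) -> forall a b, f a = f b.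
Proof.
  intros H a b.
  destruct (MVT_gen f a b (fun _ => 0)) as [c [_ Hc]].
  - intros x _; apply H.
  - intros x _; apply continuity_pt_filterlim, (ex_derive_continuous f); now exists 0.
  - lra.
Qed.

(** By induction each member is constant, and this constant is, up to [c n], the slope of
    the next one, which is zero because the next one takes equal values at [0] and [l].
    Symmetry and duplication of the Bernoulli polynomials both reduce to this. *)
Lemma Appell_sequence_eq_0 (D : nat -> R -> R) (l : R) (c : nat -> R) :
  0 < l ->
  (forall n, c n <> 0) ->
  (forall x, D 0%nat x = 0) ->
  (forall n x, is_derive (D (S n)) x (c n * D n x)) ->
  (forall n, (2 <= n)%nat -> D n l = D n 0) ->
  forall n x, D n x = 0.
Proof.
  intros Hl Hc H0 HD Hends n.
  induction n as [|n IH]; [easy|].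
  assert (Hcst : forall a b, D (S n) a = D (S n) b).
  { apply constant_of_derive_0; intros x; rewrite <- (Rmult_0_r (c n)), <- (IH x).
    apply HD. }
  intros x.
  destruct (MVT_gen (D (S (S n))) 0 l (fun y => c (S n) * D (S n) y)) as [y [_ Hy]].
  - intros y _; apply HD.
  - intros y _; apply continuity_pt_filterlim, (ex_derive_continuous (D (S (S n)))).
    eexists; apply HD.
  - rewrite Hends, (Hcst y x), Rminus_diag, Rminus_0_r in Hy by lia.
    symmetry in Hy; apply Rmult_integral in Hy as [Hy|Hy]; [|lra].
    apply Rmult_integral in Hy as [Hy|Hy]; [now apply Hc in Hy | easy].
Qed.

Lemma bernoulli_poly_symm (n : nat) (x : R) :
  bernoulli_poly n (1 - x) = (- 1) ^ n * bernoulli_poly n x.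
Proof.
  apply Rminus_diag_uniq.
  apply (Appell_sequence_eq_0
    (fun n x => bernoulli_poly n (1 - x) - (- 1) ^ n * bernoulli_poly n x)
    1 (fun n => - INR (S n))).
  - lra.
  - intros m; apply Ropp_neq_0_compat, not_0_INR; lia.
  - intros y; rewrite !bernoulli_poly_zeroth; simpl; lra.
  - intros m y.
    apply is_derive_Reals.
    replace (- INR (S m) * _) with
      (INR (S m) * bernoulli_poly m (1 - y) * (0 - 1)
       - (- 1) ^ S m * (INR (S m) * bernoulli_poly m y)) by (simpl; ring).
    apply (derivable_pt_lim_minus (fun y => bernoulli_poly (S m) (1 - y))
             (fun y => (- 1) ^ S m * bernoulli_poly (S m) y)).
    + apply (derivable_pt_lim_comp (fun y => 1 - y) (bernoulli_poly (S m))).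
      * apply (derivable_pt_lim_minus (fun _ => 1) (fun y => y)).
        -- apply derivable_pt_lim_const.
        -- apply derivable_pt_lim_id.
      * apply is_derive_Reals, bernoulli_poly_derive.
    + apply (derivable_pt_lim_scal (bernoulli_poly (S m))).
      apply is_derive_Reals, bernoulli_poly_derive.
  - intros m Hm; rewrite Rminus_diag, Rminus_0_r, (bernoulli_poly_1 m Hm); lra.
Qed.

Lemma bernoulli_poly_duplication (n : nat) (x : R) :
  2 * bernoulli_poly n (2 * x) =
  2 ^ n * (bernoulli_poly n x + bernoulli_poly n (x + 1 / 2)).
Proof.
  apply Rminus_diag_uniq.
  apply (Appell_sequence_eq_0
    (fun n x => 2 * bernoulli_poly n (2 * x) -
       2 ^ n * (bernoulli_poly n x + bernoulli_poly n (x + 1 / 2)))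
    (1 / 2) (fun n => 2 * INR (S n))).
  - lra.
  - intros m; assert (INR (S m) <> 0) by (apply not_0_INR; lia); lra.
  - intros y; rewrite !bernoulli_poly_zeroth; simpl; lra.
  - intros m y.
    apply is_derive_Reals.
    replace (2 * INR (S m) * _) with
      (2 * (INR (S m) * bernoulli_poly m (2 * y) * (2 * 1))
       - 2 ^ S m * (INR (S m) * bernoulli_poly m y +
                    INR (S m) * bernoulli_poly m (y + 1 / 2) * (1 + 0)))
      by (simpl; ring).
    apply (derivable_pt_lim_minus (fun y => 2 * bernoulli_poly (S m) (2 * y))
      (fun y => 2 ^ S m * (bernoulli_poly (S m) y + bernoulli_poly (S m) (y + 1 / 2)))).
    + apply (derivable_pt_lim_scal (fun y => bernoulli_poly (S m) (2 * y))).
      apply (derivable_pt_lim_comp (fun y => 2 * y) (bernoulli_poly (S m))).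
      * apply (derivable_pt_lim_scal (fun y => y)), derivable_pt_lim_id.
      * apply is_derive_Reals, bernoulli_poly_derive.
    + apply (derivable_pt_lim_scal
        (fun y => bernoulli_poly (S m) y + bernoulli_poly (S m) (y + 1 / 2))).
      apply (derivable_pt_lim_plus (bernoulli_poly (S m))
               (fun y => bernoulli_poly (S m) (y + 1 / 2))).
      * apply is_derive_Reals, bernoulli_poly_derive.
      * apply (derivable_pt_lim_comp (fun y => y + 1 / 2) (bernoulli_poly (S m))).
        -- apply (derivable_pt_lim_plus (fun y => y) (fun _ => 1 / 2)).
           ++ apply derivable_pt_lim_id.
           ++ apply derivable_pt_lim_const.
        -- apply is_derive_Reals, bernoulli_poly_derive.
  - intros m Hm.
    replace (2 * (1 / 2)) with 1 by lra; replace (1 / 2 + 1 / 2) with 1 by lra.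
    rewrite Rmult_0_r, Rplus_0_l, (bernoulli_poly_1 m Hm); lra.
Qed.

Lemma bernoulli_poly_half_odd (k : nat) : bernoulli_poly (2 * k + 1) (1 / 2) = 0.
Proof.
  assert (H := bernoulli_poly_symm (2 * k + 1) (1 / 2)).
  replace (1 - 1 / 2) with (1 / 2) in H by lra.
  rewrite Nat.add_1_r, pow_1_odd in H; rewrite Nat.add_1_r; lra.
Qed.

Lemma bernoulli_poly_0_odd (k : nat) : (1 <= k)%nat -> bernoulli_poly (2 * k + 1) 0 = 0.
Proof.
  intros Hk; assert (H := bernoulli_poly_symm (2 * k + 1) 0).
  rewrite Rminus_0_r, bernoulli_poly_1 in H by lia.
  rewrite Nat.add_1_r, pow_1_odd in H; rewrite Nat.add_1_r; lra.
Qed.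

Lemma bernoulli_poly_half (n : nat) :
  2 ^ n * bernoulli_poly n (1 / 2) = - (2 ^ n - 2) * bernoulli_poly n 0.
Proof.
  assert (H := bernoulli_poly_duplication n 0).
  rewrite Rmult_0_r, Rplus_0_l in H; lra.
Qed.

(** If [g] were negative at [c], its slope would be negative somewhere before [c] and
    positive somewhere after, against the sign of [g'']. *)
Lemma concave_nonneg (g g' g'' : R -> R) (a b : R) :
  (forall x, is_derive g x (g' x)) ->
  (forall x, is_derive g' x (g'' x)) ->
  (forall x, a <= x <= b -> g'' x <= 0) ->
  g a = 0 -> g b = 0 ->
  forall c, a <= c <= b -> 0 <= g c.
Proof.
  intros Hg Hg' Hneg Ha Hb c Hc.
  destruct (Rle_or_lt 0 (g c)) as [|Hlt]; [easy|exfalso].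
  assert (Hac : a < c) by (destruct (Req_dec a c); [subst; lra | lra]).
  assert (Hcb : c < b) by (destruct (Req_dec c b); [subst; lra | lra]).
  assert (cont : forall (f f' : R -> R), (forall x, is_derive f x (f' x)) ->
            forall x, continuity_pt f x).
  { intros f f' Hf x; apply continuity_pt_filterlim, (ex_derive_continuous f).
    eexists; apply Hf. }
  destruct (MVT_gen g a c g') as [u [Hu Eu]]; [easy | intros; eapply cont, Hg |].
  destruct (MVT_gen g c b g') as [v [Hv Ev]]; [easy | intros; eapply cont, Hg |].
  rewrite Rmin_left, Rmax_right in Hu, Hv by lra.
  destruct (MVT_gen g' u v g'') as [w [Hw Ew]]; [easy | intros; eapply cont, Hg' |].
  rewrite Rmin_left, Rmax_right in Hw by lra.
  assert (Hw'' := Hneg w ltac:(lra)).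
  assert (g' u < 0) by nra.
  assert (0 < g' v) by nra.
  nra.
Qed.

(** From degree three on, each odd Bernoulli polynomial vanishes at [0] and [1/2], and its
    second derivative is a positive multiple of the previous one; so concavity
    and convexity alternate, and with them the signs. *)
Lemma bernoulli_poly_odd_sign (k : nat) (x : R) : 0 <= x <= 1 / 2 ->
  0 <= (- 1) ^ S k * bernoulli_poly (2 * k + 1) x.
Proof.
  revert x; induction k as [|k IH]; intros x Hx.
  - simpl (2 * 0 + 1)%nat; rewrite bernoulli_poly_first; simpl; lra.
  - set (n := (2 * k + 1)%nat) in *.
    assert (Hscal : forall m c y, is_derive (fun y => c * bernoulli_poly (S m) y) y
              (c * (INR (S m) * bernoulli_poly m y))).
    { intros m c y; apply (is_derive_scal (bernoulli_poly (S m))), bernoulli_poly_derive. }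
    replace (2 * S k + 1)%nat with (S (S n)) by lia.
    apply (concave_nonneg
      (fun x => (- 1) ^ S (S k) * bernoulli_poly (S (S n)) x)
      (fun x => (- 1) ^ S (S k) * (INR (S (S n)) * bernoulli_poly (S n) x))
      (fun x => (- 1) ^ S (S k) * INR (S (S n)) * (INR (S n) * bernoulli_poly n x))
      0 (1 / 2)); [..|easy].
    + intros y; apply Hscal.
    + intros y.
      apply (is_derive_ext
        (fun y => ((- 1) ^ S (S k) * INR (S (S n))) * bernoulli_poly (S n) y)).
      * intros t; apply Rmult_assoc.
      * apply Hscal.
    + intros y Hy; specialize (IH y Hy).
      assert (0 <= INR (S (S n)) * INR (S n)).
      { apply Rmult_le_pos; apply pos_INR. }
      replace ((- 1) ^ S (S k)) with (- ((- 1) ^ S k)) by (simpl; ring).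
      nra.
    + replace (S (S n)) with (2 * S k + 1)%nat by lia.
      rewrite bernoulli_poly_0_odd by lia; ring.
    + replace (S (S n)) with (2 * S k + 1)%nat by lia.
      rewrite bernoulli_poly_half_odd; ring.
Qed.

(** On [[0, 1/2]] the derivative of the even Bernoulli polynomial has constant sign, so
    its values lie between the extreme ones, [B_2k] and
    [- (1 - 2 ^ (1 - 2k)) B_2k]; the other half follows by symmetry. *)
Lemma bernoulli_poly_even_bound (k : nat) (x : R) : (1 <= k)%nat -> 0 <= x <= 1 ->
  Rabs (bernoulli_poly (2 * k) x) <= Rabs (bernoulli_poly (2 * k) 0).
Proof.
  intros Hk.
  enough (Hleft : forall x, 0 <= x <= 1 -> x <= 1 / 2 ->
            Rabs (bernoulli_poly (2 * k) x) <= Rabs (bernoulli_poly (2 * k) 0)).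
  { intros Hx; destruct (Rle_or_lt x (1 / 2)) as [H|H]; [now apply Hleft|].
    assert (E := bernoulli_poly_symm (2 * k) x).
    rewrite pow_1_even, Rmult_1_l in E; rewrite <- E; apply Hleft; lra. }
  clear x; intros x Hx Hhalf.
  set (n := (2 * k)%nat).
  assert (Hpow : 2 <= 2 ^ n).
  { replace 2 with (2 ^ 1) at 1 by ring; apply Rle_pow; [lra|lia]. }
  assert (Hh := bernoulli_poly_half n).
  assert (mono : forall a b, 0 <= a <= b -> b <= 1 / 2 ->
            (- 1) ^ k * bernoulli_poly n a <= (- 1) ^ k * bernoulli_poly n b).
  { intros a b Hab Hb.
    destruct (MVT_gen (bernoulli_poly n) a b (fun y => INR n * bernoulli_poly (pred n) y))
      as [c [Hc Ec]].
    - intros y _; destruct n as [|n'] eqn:En; [lia|]; apply bernoulli_poly_derive.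
    - intros y _; apply continuity_pt_filterlim, (ex_derive_continuous (bernoulli_poly n)).
      destruct n as [|n'] eqn:En; [lia|]; eexists; apply bernoulli_poly_derive.
    - rewrite Rmin_left, Rmax_right in Hc by lra.
      assert (Hs := bernoulli_poly_odd_sign (pred k) c ltac:(lra)).
      replace (S (pred k)) with k in Hs by lia.
      replace (2 * pred k + 1)%nat with (pred n) in Hs by lia.
      assert (0 <= INR n) by apply pos_INR.
      assert (0 <= (INR n * (b - a)) * ((- 1) ^ k * bernoulli_poly (pred n) c)).
      { apply Rmult_le_pos; [apply Rmult_le_pos; lra | easy]. }
      nra. }
  assert (M1 := mono 0 x ltac:(lra) ltac:(lra)).
  assert (M2 := mono x (1 / 2) ltac:(lra) ltac:(lra)).
  assert (Hs : (- 1) ^ k = 1 \/ (- 1) ^ k = - 1).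
  { clear; induction k as [|k IH]; simpl; lra. }
  set (s := (- 1) ^ k) in *.
  rewrite <- (Rmult_1_l (Rabs (bernoulli_poly n x))),
    <- (Rmult_1_l (Rabs (bernoulli_poly n 0))).
  replace 1 with (Rabs s) by (destruct Hs as [-> | ->]; unfold Rabs; destruct Rcase_abs; lra).
  rewrite <- !Rabs_mult.
  assert (Hh' : 2 ^ n * (s * bernoulli_poly n (1 / 2))
                = - (2 ^ n - 2) * (s * bernoulli_poly n 0)).
  { transitivity (s * (2 ^ n * bernoulli_poly n (1 / 2))); [ring | rewrite Hh; ring]. }
  set (u := s * bernoulli_poly n 0) in *.
  set (v := s * bernoulli_poly n x) in *.
  set (w := s * bernoulli_poly n (1 / 2)) in *.
  assert (u <= 0) by nra.
  assert (w <= - u) by nra.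
  rewrite (Rabs_left1 u) by easy; apply Rabs_le; lra.
Qed.

(** * The complex exponential and logarithm, and a mean value inequality *)

Lemma Cexp_plus (a b : C) : Cexp (a + b) = (Cexp a * Cexp b)%C.
Proof.
  destruct a as [a1 a2], b as [b1 b2]; unfold Cexp; simpl.
  rewrite exp_plus, cos_plus, sin_plus; apply injective_projections; simpl; ring.
Qed.

Lemma Cexp_0 : Cexp 0 = 1.
Proof. unfold Cexp; simpl; rewrite exp_0, cos_0, sin_0, Rmult_1_l, Rmult_0_r; easy. Qed.

Lemma Cexp_R (x : R) : Cexp (RtoC x) = RtoC (exp x).
Proof.
  unfold Cexp; simpl; rewrite cos_0, sin_0.
  apply injective_projections; simpl; ring.
Qed.

Lemma Cmod_sqr (z : C) : Cmod z * Cmod z = Re z * Re z + Im z * Im z.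
Proof.
  transitivity (Cmod z ^ 2); [ring|]; rewrite Cmod2_alt; ring.
Qed.

Lemma im_le_Cmod (z : C) : Rabs (Im z) <= Cmod z.
Proof.
  eapply Rle_trans; [|apply Rmax_Cmod]; apply Rmax_r.
Qed.

(** The half-angle formula; unlike the inverse cosine it is smooth across the
    positive half-line. *)
Lemma Carg_half_angle (z : C) : 0 < Cmod z + Re z ->
  Carg z = 2 * atan (Im z / (Cmod z + Re z)).
Proof.
  intros Hz.
  assert (Hr : 0 < Cmod z).
  { assert (H := re_le_Cmod z); apply Rabs_le_between in H; lra. }
  assert (Hsqr := Cmod_sqr z).
  set (r := Cmod z) in *; set (x := Re z) in *; set (y := Im z) in *.
  set (t := y / (r + x)).
  assert (Hcos : cos (2 * atan t) = x / r).
  { rewrite cos_2a_cos, cos_atan.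
    replace (2 * (1 / sqrt (1 + t²)) * (1 / sqrt (1 + t²)))
      with (2 / (sqrt (1 + t²) * sqrt (1 + t²))).
    2:{ field; apply Rgt_not_eq, sqrt_lt_R0; assert (H := Rle_0_sqr t); lra. }
    rewrite sqrt_sqrt by (assert (H := Rle_0_sqr t); lra).
    unfold t, Rsqr.
    replace (1 + y / (r + x) * (y / (r + x))) with (2 * r / (r + x)).
    - field; lra.
    - replace (y / (r + x) * (y / (r + x))) with (y * y / ((r + x) * (r + x)))
        by (field; lra).
      replace (y * y) with (r * r - x * x) by lra.
      field; lra. }
  unfold Carg; fold r x y; rewrite <- Hcos.
  assert (Hb := atan_bound t).
  destruct (Rle_dec 0 y) as [Hy|Hy].
  - apply acos_cos.
    assert (0 <= atan t); [|lra].
    rewrite <- atan_0; destruct (Req_dec 0 t) as [<-|Ht]; [lra|].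
    apply Rlt_le, atan_increasing.
    assert (0 <= t) by (unfold t; apply Rdiv_le_0_compat; lra); lra.
  - rewrite <- cos_neg, acos_cos; [lra|].
    assert (atan t < 0); [|lra].
    rewrite <- atan_0; apply atan_increasing.
    unfold t; apply Rdiv_neg_pos; lra.
Qed.

Lemma Cexp_Clog (z : C) : z <> 0 -> Cexp (Clog z) = z.
Proof.
  intros Hz; assert (Hr := proj1 (Cmod_gt_0 z) Hz).
  assert (Hre : - 1 <= Re z / Cmod z <= 1).
  { assert (H := re_le_Cmod z); apply Rabs_le_between in H.
    split; [apply Rle_div_r | apply Rle_div_l]; lra. }
  assert (Hsqr := Cmod_sqr z).
  unfold Cexp, Clog, Carg; simpl Re; simpl Im; rewrite exp_ln by easy.
  assert (Hsin : sqrt (1 - (Re z / Cmod z)²) = Rabs (Im z) / Cmod z).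
  { replace (1 - (Re z / Cmod z)²) with ((Rabs (Im z) / Cmod z)²).
    - rewrite sqrt_Rsqr; [easy|]; apply Rdiv_le_0_compat; [apply Rabs_pos | easy].
    - unfold Rsqr.
      replace (Rabs (Im z) / Cmod z * (Rabs (Im z) / Cmod z))
        with (Rabs (Im z) * Rabs (Im z) / (Cmod z * Cmod z)) by (field; lra).
      replace (Re z / Cmod z * (Re z / Cmod z))
        with (Re z * Re z / (Cmod z * Cmod z)) by (field; lra).
      rewrite <- Rabs_mult, (Rabs_right (Im z * Im z)) by nra.
      replace (Im z * Im z) with (Cmod z * Cmod z - Re z * Re z) by lra.
      field; lra. }
  destruct (Rle_dec 0 (Im z)) as [Hy|Hy].
  - rewrite cos_acos, sin_acos, Hsin, Rabs_right by lra.
    apply injective_projections; simpl; unfold Re, Im; field; lra.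
  - rewrite cos_neg, sin_neg, cos_acos, sin_acos, Hsin, Rabs_left by lra.
    apply injective_projections; simpl; unfold Re, Im; field; lra.
Qed.

Lemma Clog_R (x : R) : 0 < x -> Clog (RtoC x) = RtoC (ln x).
Proof.
  intros Hx; unfold Clog; rewrite Carg_half_angle.
  - rewrite Cmod_R, Rabs_right by lra; simpl.
    unfold Rdiv; rewrite Rmult_0_l, atan_0, Rmult_0_r; easy.
  - rewrite Cmod_R, Rabs_right by lra; simpl; lra.
Qed.

(** Defined by components, so that the real rules of differentiation and the real mean
    value theorem apply directly. *)
Definition is_Cderive (f : R -> C) (t : R) (l : C) : Prop :=
  is_derive (fun u => Re (f u)) t (Re l) /\ is_derive (fun u => Im (f u)) t (Im l).

Lemma is_Cderive_eq (f : R -> C) (t : R) (l l' : C) :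
  is_Cderive f t l -> l = l' -> is_Cderive f t l'.
Proof. now intros H <-. Qed.

Lemma is_Cderive_ext (f g : R -> C) (t : R) (l : C) :
  (forall u, f u = g u) -> is_Cderive f t l -> is_Cderive g t l.
Proof.
  intros E [H1 H2]; split; eapply is_derive_ext; try eassumption;
    intros u; simpl; now rewrite E.
Qed.

Lemma is_Cderive_const (c : C) (t : R) : is_Cderive (fun _ => c) t 0.
Proof. split; apply (is_derive_const (V := R_NormedModule)). Qed.

Lemma is_Cderive_R (f : R -> R) (t l : R) :
  is_derive f t l -> is_Cderive (fun u => RtoC (f u)) t (RtoC l).
Proof.
  intros H; split; simpl; [easy|]; apply (is_derive_const (V := R_NormedModule)).
Qed.

Lemma is_Cderive_plus (f g : R -> C) (t : R) (l m : C) :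
  is_Cderive f t l -> is_Cderive g t m ->
  is_Cderive (fun u => (f u + g u)%C) t (l + m)%C.
Proof.
  intros [H1 H2] [H3 H4]; split; simpl.
  - now apply (is_derive_plus (fun u => Re (f u)) (fun u => Re (g u))).
  - now apply (is_derive_plus (fun u => Im (f u)) (fun u => Im (g u))).
Qed.

Ltac derive_unique f l :=
  change (Derive (fun x => f x)) with (Derive f);
  rewrite (is_derive_unique f _ l) by assumption.

Lemma is_Cderive_mult (f g : R -> C) (t : R) (l m : C) :
  is_Cderive f t l -> is_Cderive g t m ->
  is_Cderive (fun u => (f u * g u)%C) t (l * g t + f t * m)%C.
Proof.
  destruct l as [l1 l2], m as [m1 m2]; intros [H1 H2] [H3 H4]; simpl in H1, H2, H3, H4.
  set (f1 := fun u => Re (f u)) in *; set (f2 := fun u => Im (f u)) in *.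
  set (g1 := fun u => Re (g u)) in *; set (g2 := fun u => Im (g u)) in *.
  split.
  - change (is_derive (fun u => f1 u * g1 u - f2 u * g2 u) t
      ((l1 * g1 t - l2 * g2 t) + (f1 t * m1 - f2 t * m2))).
    clearbody f1 f2 g1 g2; auto_derive.
    + repeat split; eexists; eassumption.
    + derive_unique f1 l1; derive_unique f2 l2; derive_unique g1 m1; derive_unique g2 m2; ring.
  - change (is_derive (fun u => f1 u * g2 u + f2 u * g1 u) t
      ((l1 * g2 t + l2 * g1 t) + (f1 t * m2 + f2 t * m1))).
    clearbody f1 f2 g1 g2; auto_derive.
    + repeat split; eexists; eassumption.
    + derive_unique f1 l1; derive_unique f2 l2; derive_unique g1 m1; derive_unique g2 m2; ring.
Qed.

Lemma is_Cderive_scal (c : C) (f : R -> C) (t : R) (l : C) :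
  is_Cderive f t l -> is_Cderive (fun u => (c * f u)%C) t (c * l)%C.
Proof.
  intros H; eapply is_Cderive_eq.
  - apply is_Cderive_mult; [apply is_Cderive_const | exact H].
  - cbv beta; ring.
Qed.

Lemma is_Cderive_minus (f g : R -> C) (t : R) (l m : C) :
  is_Cderive f t l -> is_Cderive g t m ->
  is_Cderive (fun u => (f u - g u)%C) t (l - m)%C.
Proof.
  intros Hf Hg.
  apply (is_Cderive_ext (fun u => (f u + - 1 * g u)%C)); [intros u; ring|].
  eapply is_Cderive_eq.
  - apply is_Cderive_plus; [exact Hf | apply is_Cderive_scal, Hg].
  - cbv beta; ring.
Qed.

Lemma is_Cderive_inv (f : R -> C) (t : R) (l : C) :
  is_Cderive f t l -> f t <> 0 ->
  is_Cderive (fun u => (/ f u)%C) t (- l / (f t * f t))%C.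
Proof.
  intros [H1 H2] Hf.
  assert (Hn : Re (f t) ^ 2 + Im (f t) ^ 2 <> 0).
  { rewrite <- Cmod2_alt; apply pow_nonzero, Rgt_not_eq; now apply Cmod_gt_0. }
  (* A real denominator is needed to read off the components. *)
  assert (Hd : (- l / (f t * f t))%C = (- l * (Cconj (f t) * Cconj (f t))
     * RtoC (/ (Re (f t) ^ 2 + Im (f t) ^ 2) ^ 2))%C).
  { rewrite RtoC_inv by now apply pow_nonzero.
    replace (RtoC ((Re (f t) ^ 2 + Im (f t) ^ 2) ^ 2))
      with (f t * f t * (Cconj (f t) * Cconj (f t)))%C.
    - field; split; [|easy].
      intros E; apply Hf, Cmod_eq_0; rewrite <- Cmod_conj, E; apply Cmod_0.
    - destruct (f t) as [a b]; apply injective_projections; simpl; ring. }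
  rewrite Hd; clear Hd; destruct l as [l1 l2]; simpl in H1, H2.
  set (f1 := fun u => Re (f u)) in *; set (f2 := fun u => Im (f u)) in *.
  change (f1 t ^ 2 + f2 t ^ 2 <> 0) in Hn.
  split.
  - replace (Re _) with (((- l1 * (f1 t * f1 t - f2 t * f2 t)
        - 2 * l2 * f1 t * f2 t)) / (f1 t ^ 2 + f2 t ^ 2) ^ 2)
      by (unfold f1, f2, Re, Im; simpl; unfold Rdiv; ring).
    change (is_derive (fun u => f1 u / (f1 u ^ 2 + f2 u ^ 2)) t
      ((- l1 * (f1 t * f1 t - f2 t * f2 t) - 2 * l2 * f1 t * f2 t)
       / (f1 t ^ 2 + f2 t ^ 2) ^ 2)).
    clearbody f1 f2; auto_derive.
    + repeat split; try (eexists; eassumption); intros E; apply Hn; rewrite <- E; ring.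
    + derive_unique f1 l1; derive_unique f2 l2.
      field; easy.
  - replace (Im _) with ((- l2 * (f1 t * f1 t - f2 t * f2 t)
        + 2 * l1 * f1 t * f2 t) / (f1 t ^ 2 + f2 t ^ 2) ^ 2)
      by (unfold f1, f2, Re, Im; simpl; unfold Rdiv; ring).
    change (is_derive (fun u => - f2 u / (f1 u ^ 2 + f2 u ^ 2)) t
      ((- l2 * (f1 t * f1 t - f2 t * f2 t) + 2 * l1 * f1 t * f2 t)
       / (f1 t ^ 2 + f2 t ^ 2) ^ 2)).
    clearbody f1 f2; auto_derive.
    + repeat split; try (eexists; eassumption); intros E; apply Hn; rewrite <- E; ring.
    + derive_unique f1 l1; derive_unique f2 l2.
      field; easy.
Qed.

Lemma is_Cderive_pow (f : R -> C) (t : R) (l : C) (n : nat) :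
  is_Cderive f t l ->
  is_Cderive (fun u => (f u ^ S n)%C) t (RtoC (INR (S n)) * f t ^ n * l)%C.
Proof.
  intros Hf; induction n as [|n IH].
  - apply (is_Cderive_ext f); [intros u; now rewrite Cpow_1_r|].
    eapply is_Cderive_eq; [exact Hf|]; simpl; ring.
  - apply (is_Cderive_ext (fun u => (f u * f u ^ S n)%C)); [intros u; now rewrite Cpow_S|].
    eapply is_Cderive_eq; [apply is_Cderive_mult; [exact Hf | exact IH]|].
    rewrite (S_INR (S n)), RtoC_plus, !Cpow_S; ring.
Qed.

Lemma Cmod_plus_Re_neq_0 (z : C) : 0 < Cmod z + Re z -> z <> 0.
Proof. intros Hz ->; rewrite Cmod_0 in Hz; simpl in Hz; lra. Qed.

(** The hypothesis [0 < Cmod (f t) + Re (f t)] says that [f t] is off the cut. *)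
Lemma is_Cderive_Clog (f : R -> C) (t : R) (l : C) :
  is_Cderive f t l -> 0 < Cmod (f t) + Re (f t) ->
  is_Cderive (fun u => Clog (f u)) t (l / f t)%C.
Proof.
  intros [H1 H2] Hf.
  assert (Hn : 0 < Re (f t) ^ 2 + Im (f t) ^ 2).
  { rewrite <- Cmod2_alt; apply pow_lt, Cmod_gt_0; now apply Cmod_plus_Re_neq_0. }
  assert (Hd : (l / f t)%C = (l * Cconj (f t)
     * RtoC (/ (Re (f t) ^ 2 + Im (f t) ^ 2)))%C).
  { rewrite RtoC_inv by now apply Rgt_not_eq.
    replace (RtoC (Re (f t) ^ 2 + Im (f t) ^ 2)) with (f t * Cconj (f t))%C.
    - apply Cmod_plus_Re_neq_0 in Hf; field; split; [|easy].
      intros E; apply Hf, Cmod_eq_0; rewrite <- Cmod_conj, E; apply Cmod_0.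
    - destruct (f t) as [a b]; apply injective_projections; simpl; ring. }
  rewrite Hd; clear Hd; destruct l as [l1 l2]; simpl in H1, H2.
  assert (Hmod : forall z, Cmod z = sqrt (Re z ^ 2 + Im z ^ 2)) by easy.
  rewrite Hmod in Hf.
  set (f1 := fun u => Re (f u)) in *; set (f2 := fun u => Im (f u)) in *.
  change (0 < f1 t ^ 2 + f2 t ^ 2) in Hn.
  change (0 < sqrt (f1 t ^ 2 + f2 t ^ 2) + f1 t) in Hf.
  assert (Hr : 0 < sqrt (f1 t ^ 2 + f2 t ^ 2)) by now apply sqrt_lt_R0.
  assert (Hsq : sqrt (f1 t ^ 2 + f2 t ^ 2) * sqrt (f1 t ^ 2 + f2 t ^ 2)
                = f1 t ^ 2 + f2 t ^ 2) by (apply sqrt_sqrt; lra).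
  split.
  - replace (Re _) with ((l1 * f1 t + l2 * f2 t) / (f1 t ^ 2 + f2 t ^ 2))
      by (unfold f1, f2, Re, Im; simpl; unfold Rdiv; ring).
    change (is_derive (fun u => ln (sqrt (f1 u ^ 2 + f2 u ^ 2))) t
      ((l1 * f1 t + l2 * f2 t) / (f1 t ^ 2 + f2 t ^ 2))).
    clearbody f1 f2; auto_derive.
    + replace (f1 t * (f1 t * 1) + f2 t * (f2 t * 1)) with (f1 t ^ 2 + f2 t ^ 2) by ring.
      repeat split; try (eexists; eassumption); easy.
    + derive_unique f1 l1; derive_unique f2 l2.
      replace (f1 t * (f1 t * 1) + f2 t * (f2 t * 1)) with (f1 t ^ 2 + f2 t ^ 2) by ring.
      rewrite <- Hsq at 3; field; lra.
  - replace (Im _) with ((l2 * f1 t - l1 * f2 t) / (f1 t ^ 2 + f2 t ^ 2))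
      by (unfold f1, f2, Re, Im; simpl; unfold Rdiv; ring).
    apply (is_derive_ext_loc
      (fun u => 2 * atan (f2 u / (sqrt (f1 u ^ 2 + f2 u ^ 2) + f1 u)))).
    + assert (Hc : continuous (fun u => sqrt (f1 u ^ 2 + f2 u ^ 2) + f1 u) t).
      { apply (ex_derive_continuous (fun u => sqrt (f1 u ^ 2 + f2 u ^ 2) + f1 u)).
        clearbody f1 f2; auto_derive.
        replace (f1 t * (f1 t * 1) + f2 t * (f2 t * 1)) with (f1 t ^ 2 + f2 t ^ 2) by ring.
        repeat split; try (eexists; eassumption); easy. }
      apply (filter_imp (fun u => 0 < sqrt (f1 u ^ 2 + f2 u ^ 2) + f1 u)).
      * intros u Hu; simpl; now rewrite Carg_half_angle.
      * apply (Hc (fun x => 0 < x)), (open_gt 0); easy.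
    + clearbody f1 f2; auto_derive.
      * replace (f1 t * (f1 t * 1) + f2 t * (f2 t * 1)) with (f1 t ^ 2 + f2 t ^ 2) by ring.
        repeat split; try (eexists; eassumption); try easy; lra.
      * derive_unique f1 l1; derive_unique f2 l2.
        replace (f1 t * (f1 t * 1) + f2 t * (f2 t * 1)) with (f1 t ^ 2 + f2 t ^ 2) by ring.
        set (r := sqrt (f1 t ^ 2 + f2 t ^ 2)) in *.
        rewrite <- Hsq.
        set (x := f1 t) in *; set (y := f2 t) in *.
        replace (1 + y * / (r + x) * (y * / (r + x) * 1)) with (2 * r / (r + x)).
        2:{ transitivity (((r + x) * (r + x) + (r * r - x ^ 2)) / ((r + x) * (r + x)));
              [field; lra | rewrite Hsq; field; lra]. }
        transitivity ((l2 * (r * (r + x) - y * y) - y * l1 * (r + x)) / (r * r * (r + x)));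
          [field; lra|].
        replace (r * (r + x) - y * y) with (x * (r + x)) by lra; field; lra.
Qed.

(** Projecting [g] on the direction of its increment reduces this to the real mean value
    theorem. It takes the place of an estimate of the integral of [g']. *)
Lemma Cmod_increment_le (g g' : R -> C) (F F' : R -> R) (a b : R) :
  a <= b ->
  (forall t, a <= t <= b -> is_Cderive g t (g' t)) ->
  (forall t, a <= t <= b -> is_derive F t (F' t)) ->
  (forall t, a <= t <= b -> Cmod (g' t) <= F' t) ->
  Cmod (g b - g a)%C <= F b - F a.
Proof.
  intros Hab Hg HF Hle.
  set (d1 := Re (g b - g a)%C); set (d2 := Im (g b - g a)%C).
  set (D := Cmod (g b - g a)%C).
  assert (HD : D * D = d1 * d1 + d2 * d2) by apply Cmod_sqr.
  assert (HD0 : 0 <= D) by apply Cmod_ge_0.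
  set (phi := fun e1 e2 e t => e1 * Re (g t) + e2 * Im (g t) - e * F t).
  assert (Hphi : forall e1 e2 e t, a <= t <= b ->
    is_derive (phi e1 e2 e) t (e1 * Re (g' t) + e2 * Im (g' t) - e * F' t)).
  { intros e1 e2 e t Ht; destruct (Hg t Ht) as [H1 H2].
    apply (is_derive_minus (fun t => e1 * Re (g t) + e2 * Im (g t)) (fun t => e * F t)).
    - apply (is_derive_plus (fun t => e1 * Re (g t)) (fun t => e2 * Im (g t)));
        now apply is_derive_scal.
    - now apply is_derive_scal, HF. }
  assert (Hdecr : forall e1 e2 e, e1 * e1 + e2 * e2 <= e * e -> 0 <= e ->
            phi e1 e2 e b <= phi e1 e2 e a).
  { intros e1 e2 e He He0.
    destruct (MVT_gen (phi e1 e2 e) a b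
      (fun t => e1 * Re (g' t) + e2 * Im (g' t) - e * F' t)) as [c [Hc Ec]].
    - intros t Ht; apply Hphi; rewrite Rmin_left, Rmax_right in Ht by easy; lra.
    - intros t Ht; apply continuity_pt_filterlim, (ex_derive_continuous (phi e1 e2 e)).
      eexists; apply Hphi; rewrite Rmin_left, Rmax_right in Ht by easy; lra.
    - rewrite Rmin_left, Rmax_right in Hc by easy.
      assert (HF' := Hle c Hc).
      assert (Hm := Cmod_sqr (g' c)).
      assert (Hm0 := Cmod_ge_0 (g' c)).
      assert (e1 * Re (g' c) + e2 * Im (g' c) <= e * Cmod (g' c)).
      { apply Rsqr_incr_0_var; [|nra]; unfold Rsqr.
        replace (e * Cmod (g' c) * (e * Cmod (g' c)))
          with (e * e * (Cmod (g' c) * Cmod (g' c))) by ring.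
        rewrite Hm.
        assert (0 <= (e1 * Im (g' c) - e2 * Re (g' c)) ^ 2) by apply pow2_ge_0.
        nra. }
      assert (e * Cmod (g' c) <= e * F' c) by now apply Rmult_le_compat_l.
      nra. }
  destruct (Req_dec D 0) as [->|HDne].
  - assert (H := Hdecr 0 0 1 ltac:(lra) ltac:(lra)); unfold phi in H; lra.
  - (* Here [phi] weighs [g] along its own increment, so [D * D <= D * (F b - F a)]. *)
    assert (H := Hdecr d1 d2 D ltac:(lra) HD0); unfold phi in H.
    assert (E1 : Re (g b) - Re (g a) = d1) by (unfold d1, Re; simpl; lra).
    assert (E2 : Im (g b) - Im (g a) = d2) by (unfold d2, Im; simpl; lra).
    nra.
Qed.

(** * The Euler-Maclaurin formula with midpoints *)

Lemma right_half_plane_shift (z : C) (u : R) : 0 <= Re z -> z <> 0 -> 0 <= u ->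
  0 < Cmod (z + RtoC u)%C + Re (z + RtoC u)%C.
Proof.
  intros Hre Hz Hu.
  assert (H0 := Cmod_ge_0 (z + RtoC u)%C).
  assert (E : Re (z + RtoC u)%C = Re z + u) by (unfold Re; simpl; ring).
  destruct (Req_dec (Cmod (z + RtoC u)%C) 0) as [H|H]; [|lra].
  destruct (Req_dec (Re z + u) 0) as [H1|H1]; [|lra].
  exfalso; apply Hz; apply Cmod_eq_0 in H.
  replace u with 0 in H by lra; rewrite Cplus_0_r in H; easy.
Qed.

(** This is where [Re z >= 0] enters the final estimate. *)
Lemma Cmod_shift_ge (z : C) (u : R) : 0 <= Re z -> 0 <= u ->
  Cmod z ^ 2 + u ^ 2 <= Cmod (z + RtoC u)%C ^ 2.
Proof.
  intros Hre Hu; rewrite !Cmod2_alt; unfold Re, Im in *; simpl; nra.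
Qed.

Lemma Csum_n_Sm (a : nat -> C) (n m : nat) : (n <= S m)%nat ->
  sum_n_m a n (S m) = (sum_n_m a n m + a (S m))%C.
Proof. exact (sum_n_Sm a n m). Qed.

(** Stirling's series for [ln Gamma (z + 1/2)], truncated and without its constant. *)
Definition stirling_main (k : nat) (z : C) : C :=
  (z * Clog z - z + sum_n_m (fun j => T_hat j z) 1 k)%C.

(** [euler_maclaurin n s z u] is the sum over [m <= n + 1] of
    [(-1)^m B_m(s + u) / m!] times the derivative of order [m - 1] of [Clog] at [z + u],
    an antiderivative being meant for [m = 0]. *)
Fixpoint euler_maclaurin (n : nat) (s : R) (z : C) (u : R) : C :=
  match n with
  | O => ((z + RtoC u) * Clog (z + RtoC u) - (z + RtoC u)
          - RtoC (bernoulli_poly 1 (s + u)) * Clog (z + RtoC u))%C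
  | S m => (euler_maclaurin m s z u
            + RtoC (bernoulli_poly (S (S m)) (s + u) / (INR (S (S m)) * INR (S m)))
              * (/ (z + RtoC u)) ^ S m)%C
  end.

Lemma bernoulli_poly_shift_derive (n : nat) (s u : R) :
  is_derive (fun u => bernoulli_poly (S n) (s + u)) u (INR (S n) * bernoulli_poly n (s + u)).
Proof.
  replace (INR (S n) * _) with (scal 1 (INR (S n) * bernoulli_poly n (s + u)))
    by (unfold scal; simpl; unfold mult; simpl; ring).
  apply (is_derive_comp (bernoulli_poly (S n)) (fun u => s + u)).
  - apply bernoulli_poly_derive.
  - auto_derive; [easy|ring].
Qed.

Lemma is_Cderive_shift (z : C) (u : R) : is_Cderive (fun u => (z + RtoC u)%C) u 1.
Proof.
  eapply is_Cderive_eq.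
  - apply is_Cderive_plus; [apply is_Cderive_const|].
    apply (is_Cderive_R (fun u => u)), (is_derive_id (K := R_AbsRing)).
  - unfold one; simpl; ring.
Qed.

(** Consecutive terms are matched so that their derivatives telescope. *)
Lemma euler_maclaurin_derive (n : nat) (s : R) (z : C) (u : R) :
  0 < Cmod (z + RtoC u)%C + Re (z + RtoC u)%C ->
  is_Cderive (euler_maclaurin n s z) u
    (- (RtoC (bernoulli_poly (S n) (s + u) / INR (S n)) * (/ (z + RtoC u)) ^ S n))%C.
Proof.
  intros Hzu; assert (Hne := Cmod_plus_Re_neq_0 _ Hzu).
  assert (Hsh := is_Cderive_shift z u).
  induction n as [|n IH].
  - assert (Hlog := is_Cderive_Clog _ _ _ Hsh Hzu); cbv beta in Hlog.
    eapply is_Cderive_eq.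
    + apply is_Cderive_minus.
      * apply is_Cderive_minus; [apply is_Cderive_mult; eassumption | exact Hsh].
      * apply is_Cderive_mult; [|exact Hlog].
        apply (is_Cderive_R (fun u => bernoulli_poly 1 (s + u))).
        apply bernoulli_poly_shift_derive.
    + cbv beta; rewrite bernoulli_poly_zeroth; simpl (INR 1).
      rewrite Rmult_1_l, Rdiv_1_r, Cpow_1_r; field; easy.
  - eapply is_Cderive_eq.
    + apply is_Cderive_plus; [exact IH|].
      apply is_Cderive_mult.
      * apply (is_Cderive_R (fun u => bernoulli_poly (S (S n)) (s + u)
                                       / (INR (S (S n)) * INR (S n)))).
        apply (is_derive_ext (fun u => / (INR (S (S n)) * INR (S n))
                                       * bernoulli_poly (S (S n)) (s + u))).
        { intros t; apply Rmult_comm. }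
        apply (is_derive_scal (fun u => bernoulli_poly (S (S n)) (s + u))).
        apply bernoulli_poly_shift_derive.
      * apply is_Cderive_pow, is_Cderive_inv; [exact Hsh | exact Hne].
    + cbv beta.
      assert (H1 : INR (S n) <> 0) by (apply not_0_INR; lia).
      assert (H2 : INR (S (S n)) <> 0) by (apply not_0_INR; lia).
      replace (/ (INR (S (S n)) * INR (S n)) * (INR (S (S n)) * bernoulli_poly (S n) (s + u)))
        with (bernoulli_poly (S n) (s + u) / INR (S n)) by (field; easy).
      replace (bernoulli_poly (S (S n)) (s + u) / INR (S (S n)))
        with (bernoulli_poly (S (S n)) (s + u) / (INR (S (S n)) * INR (S n)) * INR (S n))
        by (field; easy).
      rewrite (RtoC_mult _ (INR (S n))), (Cpow_S _ (S n)), (Cpow_S _ n).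
      field; easy.
Qed.

(** At the start of the first and at the end of the second half of a unit interval the
    Bernoulli polynomials are taken at [1/2], where those of odd index vanish; what is left
    is Stirling's series. *)
Lemma euler_maclaurin_half (k : nat) (s u : R) (z : C) : s + u = 1 / 2 ->
  (z + RtoC u)%C <> 0 ->
  euler_maclaurin (2 * k + 1) s z u = stirling_main (S k) (z + RtoC u)%C.
Proof.
  intros Hsu Hne.
  assert (HT : forall j, (RtoC (bernoulli_poly (S (S (2 * j))) (1 / 2)
      / (INR (S (S (2 * j))) * INR (S (2 * j)))) * (/ (z + RtoC u)) ^ S (2 * j))%C
      = T_hat (S j) (z + RtoC u)%C).
  { intros j; unfold T_hat.
    replace (2 * S j)%nat with (S (S (2 * j))) by lia.
    replace (S (S (2 * j)) - 1)%nat with (S (2 * j)) by lia.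
    assert (H1 : INR (S (2 * j)) <> 0) by (apply not_0_INR; lia).
    assert (H2 : INR (S (S (2 * j))) <> 0) by (apply not_0_INR; lia).
    rewrite Cpow_inv, RtoC_div, RtoC_mult by (try easy; now apply Rmult_integral_contrapositive).
    field; repeat split; try (now apply Cpow_nz); intros E; apply RtoC_inj in E; easy. }
  induction k as [|k IH].
  - simpl euler_maclaurin; rewrite Hsu; unfold stirling_main.
    rewrite sum_n_n, <- (HT 0%nat), bernoulli_poly_first.
    replace (1 / 2 - 1 / 2) with 0 by lra; simpl; ring.
  - unfold stirling_main in *.
    rewrite Csum_n_Sm by lia.
    replace (2 * S k + 1)%nat with (S (S (2 * k + 1))) by lia.
    change (euler_maclaurin (S (S (2 * k + 1))) s z u) with
      (euler_maclaurin (2 * k + 1) s z u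
       + RtoC (bernoulli_poly (S (S (2 * k + 1))) (s + u)
               / (INR (S (S (2 * k + 1))) * INR (S (2 * k + 1))))
         * (/ (z + RtoC u)) ^ S (2 * k + 1)
       + RtoC (bernoulli_poly (S (S (S (2 * k + 1)))) (s + u)
               / (INR (S (S (S (2 * k + 1)))) * INR (S (S (2 * k + 1)))))
         * (/ (z + RtoC u)) ^ S (S (2 * k + 1)))%C.
    rewrite IH, Hsu, <- (HT (S k)).
    replace (S (S (2 * k + 1))) with (2 * S k + 1)%nat by lia.
    rewrite bernoulli_poly_half_odd.
    replace (S (2 * k + 1)) with (2 * S k)%nat by lia.
    replace (2 * S k + 1)%nat with (S (2 * S k)) by lia.
    rewrite Rdiv_0_l; ring.
Qed.

(** Among the periodic Bernoulli functions only that of index one jumps; at the midpoint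
    of a unit interval its jump of size one brings in the value of [Clog] there. *)
Lemma euler_maclaurin_jump (n : nat) (s1 s2 u : R) (z : C) :
  s1 + u = 1 -> s2 + u = 0 ->
  (euler_maclaurin n s2 z u - euler_maclaurin n s1 z u)%C = Clog (z + RtoC u)%C.
Proof.
  intros H1 H2; induction n as [|n IH]; simpl.
  - rewrite H1, H2, !bernoulli_poly_first.
    replace (1 - 1 / 2) with (1 / 2) by lra; replace (0 - 1 / 2) with (- (1 / 2)) by lra.
    rewrite RtoC_opp, RtoC_div by lra; field.
  - rewrite <- IH, H1, H2, bernoulli_poly_1 by lia; ring.
Qed.

(** [inv_pow_primitive k] is an antiderivative of [1 / (1 + u ^ 2) ^ (k + 1)]. *)
Fixpoint inv_pow_primitive (k : nat) (u : R) : R :=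
  match k with
  | O => atan u
  | S m => u / (2 * INR (S m) * (1 + u ^ 2) ^ S m)
           + (2 * INR (S m) - 1) / (2 * INR (S m)) * inv_pow_primitive m u
  end.

(** The integral of [1 / (1 + u ^ 2) ^ (k + 1)] over the positive half-line. *)
Fixpoint inv_pow_integral (k : nat) : R :=
  match k with
  | O => PI / 2
  | S m => (2 * INR (S m) - 1) / (2 * INR (S m)) * inv_pow_integral m
  end.

Lemma inv_pow_primitive_derive (k : nat) (u : R) :
  is_derive (inv_pow_primitive k) u (/ (1 + u ^ 2) ^ S k).
Proof.
  assert (Hq : 0 < 1 + u ^ 2) by (assert (H := pow2_ge_0 u); lra).
  induction k as [|k IH].
  - apply (is_derive_ext atan); [easy|].
    replace (/ (1 + u ^ 2) ^ 1) with (/ (1 + u ^ 2)) by (simpl; field; nra).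
    apply is_derive_Reals, derivable_pt_lim_atan.
  - set (K := INR (S k)).
    assert (HK : K <> 0) by (apply not_0_INR; lia).
    assert (Hp := pow_nonzero (1 + u ^ 2) (S k) ltac:(lra)).
    replace (/ (1 + u ^ 2) ^ S (S k)) with
      ((1 * (2 * K * (1 + u ^ 2) ^ S k)
        - u * (2 * K * (K * (2 * u) * (1 + u ^ 2) ^ k))) / (2 * K * (1 + u ^ 2) ^ S k) ^ 2
       + (2 * K - 1) / (2 * K) * / (1 + u ^ 2) ^ S k).
    + apply (is_derive_plus (fun u => u / (2 * K * (1 + u ^ 2) ^ S k))
               (fun u => (2 * K - 1) / (2 * K) * inv_pow_primitive k u)).
      * apply (is_derive_div (fun u => u) (fun u => 2 * K * (1 + u ^ 2) ^ S k)).
        -- apply (is_derive_id (K := R_AbsRing)).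
        -- apply (is_derive_scal (fun u => (1 + u ^ 2) ^ S k)).
           apply (is_derive_pow (fun u => 1 + u ^ 2) (S k) u (2 * u)).
           auto_derive; [easy|ring].
        -- apply Rmult_integral_contrapositive; split; [lra|easy].
      * now apply is_derive_scal.
    + set (q := 1 + u ^ 2) in *; set (Q := q ^ k) in *.
      change (q ^ S (S k)) with (q * (q * Q)); change (q ^ S k) with (q * Q) in *.
      assert (E : u ^ 2 = q - 1) by (unfold q; ring).
      assert (HQ : Q <> 0) by (apply pow_nonzero; lra).
      transitivity ((2 * K * (q * Q) - 4 * K * K * u ^ 2 * Q) / (2 * K * (q * Q)) ^ 2
         + (2 * K - 1) / (2 * K) / (q * Q)); [field; repeat split; lra|].
      rewrite E; field; repeat split; lra.
Qed.

(** As a function of [u], an antiderivative of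
    [|B_(2k+2)| / (2k + 2) / (r ^ 2 + u ^ 2) ^ (k + 1)]. With [r = Cmod z] this bounds the
    derivative of [euler_maclaurin (2 * k + 1)] in [u]. *)
Definition remainder_majorant (k : nat) (r u : R) : R :=
  Rabs (bernoulli_poly (2 * S k) 0) / INR (2 * S k) / r ^ S (2 * k)
  * inv_pow_primitive k (u / r).

Lemma remainder_majorant_derive (k : nat) (r u : R) : 0 < r ->
  is_derive (remainder_majorant k r) u
    (Rabs (bernoulli_poly (2 * S k) 0) / INR (2 * S k) / (r ^ 2 + u ^ 2) ^ S k).
Proof.
  intros Hr; unfold remainder_majorant.
  set (M := _ / INR (2 * S k)).
  assert (Hq : 0 < 1 + (u / r) ^ 2) by (assert (H := pow2_ge_0 (u / r)); lra).
  replace (M / (r ^ 2 + u ^ 2) ^ S k)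
    with (M / r ^ S (2 * k) * (/ r * / (1 + (u / r) ^ 2) ^ S k)).
  - apply (is_derive_scal (fun u => inv_pow_primitive k (u / r))).
    apply (is_derive_comp (inv_pow_primitive k) (fun u => u / r)).
    + apply inv_pow_primitive_derive.
    + auto_derive; [lra | field; lra].
  - replace (r ^ 2 + u ^ 2) with (r ^ 2 * (1 + (u / r) ^ 2)) by (field; lra).
    rewrite Rpow_mult_distr, <- pow_mult.
    replace (2 * S k)%nat with (S (S (2 * k))) by lia.
    rewrite <- (tech_pow_Rmult r (S (2 * k))).
    field; repeat split; try lra; apply pow_nonzero; lra.
Qed.

Lemma euler_maclaurin_increment (k : nat) (s a b : R) (z : C) :
  0 <= Re z -> z <> 0 -> 0 <= a <= b -> 0 <= s + a -> s + b <= 1 ->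
  Cmod (euler_maclaurin (2 * k + 1) s z b - euler_maclaurin (2 * k + 1) s z a)%C
  <= remainder_majorant k (Cmod z) b - remainder_majorant k (Cmod z) a.
Proof.
  intros Hre Hz Hab Ha Hb; assert (Hr := proj1 (Cmod_gt_0 z) Hz).
  eapply Cmod_increment_le; [easy|..].
  - intros t Ht; apply euler_maclaurin_derive, right_half_plane_shift; [easy|easy|lra].
  - intros t Ht; now apply remainder_majorant_derive.
  - intros t Ht; replace (S (2 * k + 1)) with (2 * S k)%nat by lia.
    assert (Hne := Cmod_plus_Re_neq_0 _ (right_half_plane_shift z t Hre Hz ltac:(lra))).
    assert (HN : 0 < INR (2 * S k)) by (apply lt_0_INR; lia).
    rewrite Cmod_opp, Cmod_mult, Cmod_R, Cmod_pow, Cmod_inv by easy.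
    unfold Rdiv; rewrite Rabs_mult, (Rabs_right (/ _))
      by (apply Rle_ge, Rlt_le, Rinv_0_lt_compat; easy).
    apply Rmult_le_compat.
    + apply Rmult_le_pos; [apply Rabs_pos | now apply Rlt_le, Rinv_0_lt_compat].
    + apply pow_le, Rlt_le, Rinv_0_lt_compat; now apply Cmod_gt_0.
    + apply Rmult_le_compat_r; [now apply Rlt_le, Rinv_0_lt_compat|].
      apply bernoulli_poly_even_bound; [lia|lra].
    + rewrite pow_inv, pow_mult.
      assert (H := Cmod_shift_ge z t Hre ltac:(lra)).
      assert (0 < Cmod z ^ 2) by now apply pow_lt.
      assert (0 <= t ^ 2) by apply pow2_ge_0.
      apply Rinv_le_contravar; [apply pow_lt; lra | apply pow_incr; lra].
Qed.

(** On the left half of the unit interval the argument of the Bernoulli polynomials runs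
    from [1/2] to [1], on the right half from [0] to [1/2]. *)
Lemma stirling_main_step (k j : nat) (z : C) : 0 <= Re z -> z <> 0 ->
  Cmod (Clog (z + RtoC (INR j + 1 / 2))
        - (stirling_main (S k) (z + RtoC (INR (S j)))
           - stirling_main (S k) (z + RtoC (INR j))))%C
  <= remainder_majorant k (Cmod z) (INR (S j)) - remainder_majorant k (Cmod z) (INR j).
Proof.
  intros Hre Hz.
  assert (Hj := pos_INR j); rewrite S_INR; set (x := INR j) in *.
  assert (Hne : forall u, 0 <= u -> (z + RtoC u)%C <> 0).
  { intros u Hu; now apply Cmod_plus_Re_neq_0, right_half_plane_shift. }
  assert (H1 := euler_maclaurin_increment k (1 / 2 - x) x (x + 1 / 2) z Hre Hz
                  ltac:(lra) ltac:(lra) ltac:(lra)).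
  assert (H2 := euler_maclaurin_increment k (- 1 / 2 - x) (x + 1 / 2) (x + 1) z Hre Hz
                  ltac:(lra) ltac:(lra) ltac:(lra)).
  rewrite <- (euler_maclaurin_jump (2 * k + 1) (1 / 2 - x) (- 1 / 2 - x)) by lra.
  rewrite <- (euler_maclaurin_half k (1 / 2 - x) x z) by (try apply Hne; lra).
  rewrite <- (euler_maclaurin_half k (- 1 / 2 - x) (x + 1) z) by (try apply Hne; lra).
  set (e1 := euler_maclaurin _ (1 / 2 - x) z x) in *.
  set (e2 := euler_maclaurin _ (1 / 2 - x) z (x + 1 / 2)) in *.
  set (e3 := euler_maclaurin _ (- 1 / 2 - x) z (x + 1 / 2)) in *.
  set (e4 := euler_maclaurin _ (- 1 / 2 - x) z (x + 1)) in *.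
  replace (e3 - e2 - (e4 - e1))%C with (- ((e2 - e1) + (e4 - e3)))%C by ring.
  rewrite Cmod_opp; eapply Rle_trans; [apply Cmod_triangle | lra].
Qed.

(** * Convergence of the Euler-Maclaurin error *)

Definition is_Clim_seq (s : nat -> C) (l : C) : Prop :=
  is_lim_seq (fun n => Re (s n)) (Re l) /\ is_lim_seq (fun n => Im (s n)) (Im l).

(** Adding [f] makes [s] nondecreasing. *)
Lemma ex_lim_seq_dominated (s f : nat -> R) (M : R) :
  (forall n, Rabs (s (S n) - s n) <= f (S n) - f n) ->
  (forall n, f n <= M) -> ex_finite_lim_seq s.
Proof.
  intros Hs Hf.
  assert (Hinc : ex_finite_lim_seq f).
  { apply (ex_finite_lim_seq_incr f M); [|easy].
    intros n; assert (H := Hs n); assert (H0 := Rabs_pos (s (S n) - s n)); lra. }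
  assert (Hsum : ex_finite_lim_seq (fun n => s n + f n)).
  { assert (Hb : forall n, Rabs (s n - s 0%nat) <= f n - f 0%nat).
    { induction n as [|n IH]; [rewrite !Rminus_diag, Rabs_R0; lra|].
      replace (s (S n) - s 0%nat) with ((s (S n) - s n) + (s n - s 0%nat)) by ring.
      eapply Rle_trans; [apply Rabs_triang|]; specialize (Hs n); lra. }
    apply (ex_finite_lim_seq_incr _ (s 0%nat + (M - f 0%nat) + M)).
    - intros n; specialize (Hs n); apply Rabs_le_between in Hs; lra.
    - intros n; specialize (Hb n); specialize (Hf n); apply Rabs_le_between in Hb; lra. }
  destruct Hinc as [l Hl], Hsum as [m Hm]; exists (m - l).
  apply (is_lim_seq_ext (fun n => (s n + f n) - f n)); [intros n; ring|].
  now apply is_lim_seq_minus'.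
Qed.

Lemma ex_Clim_seq_dominated (s : nat -> C) (f : nat -> R) (M : R) :
  (forall n, Cmod (s (S n) - s n)%C <= f (S n) - f n) ->
  (forall n, f n <= M) -> exists l, is_Clim_seq s l.
Proof.
  intros Hs Hf.
  destruct (ex_lim_seq_dominated (fun n => Re (s n)) f M) as [a Ha].
  { intros n; eapply Rle_trans; [|apply Hs].
    replace (Re (s (S n)) - Re (s n)) with (Re (s (S n) - s n)%C) by (unfold Re; simpl; ring).
    apply re_le_Cmod. }
  { easy. }
  destruct (ex_lim_seq_dominated (fun n => Im (s n)) f M) as [b Hb].
  { intros n; eapply Rle_trans; [|apply Hs].
    replace (Im (s (S n)) - Im (s n)) with (Im (s (S n) - s n)%C) by (unfold Im; simpl; ring).
    apply im_le_Cmod. }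
  { easy. }
  now exists (a, b).
Qed.

Lemma is_lim_seq_sqr (u : nat -> R) (l : R) :
  is_lim_seq u l -> is_lim_seq (fun n => u n ^ 2) (l ^ 2).
Proof.
  intros H; simpl (l ^ 2); rewrite Rmult_1_r.
  apply (is_lim_seq_ext (fun n => u n * u n)); [intros n; ring|].
  now apply is_lim_seq_mult'.
Qed.

Lemma is_Clim_seq_Cmod (s : nat -> C) (l : C) :
  is_Clim_seq s l -> is_lim_seq (fun n => Cmod (s n)) (Cmod l).
Proof.
  intros [H1 H2].
  apply (is_lim_seq_continuous sqrt (fun n => Re (s n) ^ 2 + Im (s n) ^ 2)
           (Re l ^ 2 + Im l ^ 2)).
  - apply continuity_pt_sqrt.
    assert (H := pow2_ge_0 (Re l)); assert (H' := pow2_ge_0 (Im l)); lra.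
  - apply is_lim_seq_plus'; now apply is_lim_seq_sqr.
Qed.

Lemma is_Clim_seq_plus (s t : nat -> C) (l m : C) :
  is_Clim_seq s l -> is_Clim_seq t m -> is_Clim_seq (fun n => (s n + t n)%C) (l + m)%C.
Proof. intros [] []; split; simpl; now apply is_lim_seq_plus'. Qed.

Lemma is_Clim_seq_minus (s t : nat -> C) (l m : C) :
  is_Clim_seq s l -> is_Clim_seq t m -> is_Clim_seq (fun n => (s n - t n)%C) (l - m)%C.
Proof.
  intros [H1 H2] [H3 H4]; split; simpl.
  - now apply (is_lim_seq_minus' _ _ (Re l) (Re m)).
  - now apply (is_lim_seq_minus' _ _ (Im l) (Im m)).
Qed.

Lemma is_Clim_seq_ext (s t : nat -> C) (l : C) :
  (forall n, s n = t n) -> is_Clim_seq s l -> is_Clim_seq t l.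
Proof.
  intros E [H1 H2]; split; eapply is_lim_seq_ext; try eassumption;
    intros n; simpl; now rewrite E.
Qed.

Lemma is_Clim_seq_const (l : C) : is_Clim_seq (fun _ => l) l.
Proof. split; apply is_lim_seq_const. Qed.

Lemma is_Clim_seq_0 (s : nat -> C) (f : nat -> R) :
  (forall n, Cmod (s n) <= f n) -> is_lim_seq f 0 -> is_Clim_seq s 0.
Proof.
  intros Hs Hf; split; simpl; apply is_lim_seq_abs_0;
    (eapply is_lim_seq_le_le; [|apply (is_lim_seq_const 0)|exact Hf]);
    intros n; (split; [apply Rabs_pos|]); (eapply Rle_trans; [|apply Hs]);
    [apply re_le_Cmod | apply im_le_Cmod].
Qed.

Lemma is_lim_seq_inv_INR (a : R) : is_lim_seq (fun n => a / INR (S n)) 0.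
Proof.
  replace 0 with (a * 0) by ring.
  apply is_lim_seq_mult'; [apply is_lim_seq_const|].
  apply (is_lim_seq_incr_1 (fun n => / INR n)).
  replace (Finite 0) with (Rbar_inv p_infty) by easy.
  apply is_lim_seq_inv; [apply is_lim_seq_INR | easy].
Qed.

Lemma is_lim_seq_atan (r : R) : 0 < r -> is_lim_seq (fun n => atan (INR n / r)) (PI / 2).
Proof.
  intros Hr; apply is_lim_seq_incr_1.
  assert (Hp : forall n, 0 < INR (S n)) by (intros n; apply lt_0_INR; lia).
  apply (is_lim_seq_ext (fun n => PI / 2 - atan (r / INR (S n)))).
  { intros n; replace (r / INR (S n)) with (/ (INR (S n) / r)).
    - rewrite atan_inv; [ring|]; apply Rdiv_lt_0_compat; auto.
    - specialize (Hp n); field; lra. }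
  replace (PI / 2) with (PI / 2 - atan 0) at 1 by (rewrite atan_0; ring).
  apply is_lim_seq_minus'; [apply is_lim_seq_const|].
  apply (is_lim_seq_continuous atan); [apply derivable_continuous_pt, derivable_pt_atan|].
  apply is_lim_seq_inv_INR.
Qed.

Lemma inv_pow_primitive_lim (k : nat) (r : R) : 0 < r ->
  is_lim_seq (fun n => inv_pow_primitive k (INR n / r)) (inv_pow_integral k).
Proof.
  intros Hr; induction k as [|k IH]; [now apply is_lim_seq_atan|].
  change (inv_pow_integral (S k)) with
    ((2 * INR (S k) - 1) / (2 * INR (S k)) * inv_pow_integral k).
  rewrite <- (Rplus_0_l (_ * inv_pow_integral k)).
  apply (is_lim_seq_ext (fun n => INR n / r / (2 * INR (S k) * (1 + (INR n / r) ^ 2) ^ S k)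
    + (2 * INR (S k) - 1) / (2 * INR (S k)) * inv_pow_primitive k (INR n / r))); [easy|].
  apply is_lim_seq_plus'.
  - assert (HK : 1 <= INR (S k)) by (apply (le_INR 1); lia).
    apply is_lim_seq_incr_1.
    assert (Hp : forall n, 0 < INR (S n)) by (intros n; apply lt_0_INR; lia).
    apply (is_lim_seq_le_le (fun _ => 0) _ (fun n => r / INR (S n))).
    + intros n; specialize (Hp n); set (x := INR (S n) / r).
      assert (Hx : 0 < x) by now apply Rdiv_lt_0_compat.
      assert (Hx2 := pow2_ge_0 x).
      assert (Hq : x ^ 2 <= (1 + x ^ 2) ^ S k).
      { rewrite <- (tech_pow_Rmult (1 + x ^ 2)).
        assert (H1 : 1 <= (1 + x ^ 2) ^ k) by (apply pow_R1_Rle; lra).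
        set (Q := (1 + x ^ 2) ^ k) in *; clearbody Q.
        assert (0 <= x ^ 2 * (Q - 1)) by (apply Rmult_le_pos; lra); lra. }
      replace (r / INR (S n)) with (/ x) by (unfold x; field; lra).
      split.
      * apply Rdiv_le_0_compat; [lra|].
        apply Rmult_lt_0_compat; [lra|]; apply pow_lt; lra.
      * apply Rle_div_l; [apply Rmult_lt_0_compat; [lra|]; apply pow_lt; lra|].
        apply (Rmult_le_reg_l x); [easy|].
        rewrite <- Rmult_assoc, Rinv_r, Rmult_1_l by lra.
        set (Q := (1 + x ^ 2) ^ S k) in *; clearbody Q; nra.
    + apply is_lim_seq_const.
    + apply is_lim_seq_inv_INR.
  - apply is_lim_seq_mult'; [apply is_lim_seq_const | exact IH].
Qed.

Definition remainder_bound (k : nat) (r : R) : R :=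
  Rabs (bernoulli_poly (2 * S k) 0) / INR (2 * S k) / r ^ S (2 * k) * inv_pow_integral k.

Lemma remainder_majorant_lim (k : nat) (r : R) : 0 < r ->
  is_lim_seq (fun n => remainder_majorant k r (INR n)) (remainder_bound k r).
Proof.
  intros Hr; apply is_lim_seq_mult'; [apply is_lim_seq_const|].
  now apply inv_pow_primitive_lim.
Qed.

Lemma remainder_majorant_0 (k : nat) (r : R) : remainder_majorant k r 0 = 0.
Proof.
  unfold remainder_majorant; rewrite Rdiv_0_l.
  assert (E : inv_pow_primitive k 0 = 0).
  { induction k as [|k IH]; simpl; [apply atan_0|]; rewrite IH; unfold Rdiv; ring. }
  rewrite E; ring.
Qed.

(** The telescoping part is kept inside the sum, so that consecutive terms are controlled by
    [stirling_main_step]. *)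
Fixpoint stirling_error (k : nat) (z : C) (n : nat) : C :=
  match n with
  | O => 0
  | S j => (stirling_error k z j + (Clog (z + RtoC (INR j + 1 / 2))
        - (stirling_main (S k) (z + RtoC (INR (S j)))
           - stirling_main (S k) (z + RtoC (INR j)))))%C
  end.

Lemma stirling_error_lim (k : nat) (z : C) : 0 <= Re z -> z <> 0 ->
  exists e, is_Clim_seq (stirling_error k z) e
            /\ Cmod e <= remainder_bound k (Cmod z).
Proof.
  intros Hre Hz; assert (Hr := proj1 (Cmod_gt_0 z) Hz).
  assert (Hstep : forall n, Cmod (stirling_error k z (S n) - stirling_error k z n)%C <=
    remainder_majorant k (Cmod z) (INR (S n)) - remainder_majorant k (Cmod z) (INR n)).
  { intros n; eapply Rle_trans; [|now apply stirling_main_step].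
    right; apply (f_equal Cmod); cbn [stirling_error]; ring. }
  assert (Hlim := remainder_majorant_lim k (Cmod z) Hr).
  assert (Hincr : forall n, remainder_majorant k (Cmod z) (INR n)
                            <= remainder_majorant k (Cmod z) (INR (S n))).
  { intros n; assert (H := Hstep n).
    assert (H0 := Cmod_ge_0 (stirling_error k z (S n) - stirling_error k z n)%C); lra. }
  destruct (ex_Clim_seq_dominated (stirling_error k z)
    (fun n => remainder_majorant k (Cmod z) (INR n)) (remainder_bound k (Cmod z)))
    as [e He]; [easy| |].
  { intros n; exact (is_lim_seq_incr_compare _ _ Hlim Hincr n). }
  exists e; split; [easy|].
  apply is_Clim_seq_Cmod in He.
  refine (is_lim_seq_le _ _ _ _ _ He Hlim).
  intros n; induction n as [|n IH].
  - simpl; rewrite Cmod_0, remainder_majorant_0; lra.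
  - specialize (Hstep n).
    replace (stirling_error k z (S n)) with
      (stirling_error k z n + (stirling_error k z (S n) - stirling_error k z n))%C by ring.
    eapply Rle_trans; [apply Cmod_triangle | lra].
Qed.

(** * Wallis' product and values of the gamma function *)

Definition wallis (n : nat) : R := RInt (fun t => cos t ^ n) 0 (PI / 2).

Lemma ex_RInt_cos_pow (n : nat) : ex_RInt (fun t => cos t ^ n) 0 (PI / 2).
Proof.
  apply (ex_RInt_continuous (V := R_CompleteNormedModule)); intros t _.
  apply (ex_derive_continuous (fun t => cos t ^ n)); auto_derive; easy.
Qed.

Lemma wallis_0 : wallis 0 = PI / 2.
Proof.
  unfold wallis; rewrite (RInt_ext _ (fun _ => 1)) by easy.
  rewrite RInt_const; unfold scal; simpl; unfold mult; simpl; ring.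
Qed.

Lemma wallis_1 : wallis 1 = 1.
Proof.
  apply is_RInt_unique.
  replace 1 with (minus (sin (PI / 2)) (sin 0))
    by (rewrite sin_PI2, sin_0; unfold minus, plus, opp; simpl; ring).
  apply (is_RInt_derive sin).
  - intros t _; auto_derive; [easy|ring].
  - intros t _; apply (ex_derive_continuous (fun t => cos t ^ 1)); auto_derive; easy.
Qed.

(** Integration by parts, in the form of the derivative of [sin * cos ^ (n + 1)]. *)
Lemma wallis_rec (n : nat) : (INR n + 2) * wallis (S (S n)) = (INR n + 1) * wallis n.
Proof.
  assert (H : is_RInt (fun t => (INR n + 2) * cos t ^ S (S n) - (INR n + 1) * cos t ^ n)
                0 (PI / 2) 0).
  { replace 0 with (minus (sin (PI / 2) * cos (PI / 2) ^ S n) (sin 0 * cos 0 ^ S n)) at 2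
      by (rewrite cos_PI2, sin_0, pow_i by lia; unfold minus, plus, opp; simpl; ring).
    apply (is_RInt_derive (fun t => sin t * cos t ^ S n)).
    - intros t _.
      replace (_ - _) with
        (cos t * cos t ^ S n + sin t * (INR (S n) * - sin t * cos t ^ n)).
      + apply (is_derive_mult sin (fun t => cos t ^ S n)).
        * apply is_derive_Reals, derivable_pt_lim_sin.
        * apply (is_derive_pow cos (S n) t (- sin t)).
          apply is_derive_Reals, derivable_pt_lim_cos.
        * apply Rmult_comm.
      + assert (E := sin2_cos2 t); unfold Rsqr in E.
        replace (sin t * (INR (S n) * - sin t * cos t ^ n))
          with (- INR (S n) * (sin t * sin t) * cos t ^ n) by ring.
        replace (sin t * sin t) with (1 - cos t * cos t) by lra.
        rewrite S_INR; simpl; ring.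
    - intros t _.
      apply (ex_derive_continuous
        (fun t => (INR n + 2) * cos t ^ S (S n) - (INR n + 1) * cos t ^ n)).
      auto_derive; easy. }
  apply (is_RInt_unique (V := R_CompleteNormedModule)) in H.
  rewrite (RInt_minus (V := R_CompleteNormedModule)
    (fun t => (INR n + 2) * cos t ^ S (S n)) (fun t => (INR n + 1) * cos t ^ n)) in H.
  - rewrite (RInt_scal (V := R_CompleteNormedModule) (fun t => cos t ^ S (S n))) in H
      by apply ex_RInt_cos_pow.
    rewrite (RInt_scal (V := R_CompleteNormedModule) (fun t => cos t ^ n)) in H
      by apply ex_RInt_cos_pow.
    fold (wallis n) (wallis (S (S n))) in H.
    unfold minus, plus, opp, scal in H; simpl in H; unfold mult in H; simpl in H; lra.
  - apply (ex_RInt_scal (V := R_CompleteNormedModule) (fun t => cos t ^ S (S n))),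
      ex_RInt_cos_pow.
  - apply (ex_RInt_scal (V := R_CompleteNormedModule) (fun t => cos t ^ n)),
      ex_RInt_cos_pow.
Qed.

Lemma wallis_decr (n : nat) : wallis (S n) <= wallis n.
Proof.
  assert (Hpi := PI_RGT_0).
  apply RInt_le; [lra | apply ex_RInt_cos_pow | apply ex_RInt_cos_pow|].
  intros t Ht.
  assert (0 <= cos t) by (apply cos_ge_0; lra).
  assert (cos t <= 1) by apply COS_bound.
  assert (0 <= cos t ^ n) by now apply pow_le.
  simpl; nra.
Qed.

Fixpoint Rrising (x : R) (n : nat) : R :=
  match n with
  | O => 1
  | S m => Rrising x m * (x + INR m)
  end.

Lemma rising_R (x : R) (n : nat) : rising (RtoC x) n = RtoC (Rrising x n).
Proof.
  induction n as [|n IH]; [easy|].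
  simpl rising; simpl Rrising; rewrite IH, RtoC_mult, RtoC_plus; easy.
Qed.

Lemma Rrising_pos (x : R) (n : nat) : 0 < x -> 0 < Rrising x n.
Proof.
  intros Hx; induction n as [|n IH]; simpl; [lra|].
  apply Rmult_lt_0_compat; [easy|]; assert (H := pos_INR n); lra.
Qed.

Lemma wallis_odd (n : nat) : 2 * wallis (S (2 * n)) * Rrising (1 / 2) (S n) = INR (fact n).
Proof.
  induction n as [|n IH].
  - simpl (2 * 0)%nat; rewrite wallis_1; simpl; lra.
  - replace (S (2 * S n)) with (S (S (S (2 * n)))) by lia.
    assert (H := wallis_rec (S (2 * n))).
    rewrite S_INR, mult_INR in H; change (INR 2) with 2 in H.
    rewrite fact_simpl, mult_INR, <- IH, S_INR.
    change (Rrising (1 / 2) (S (S n))) with (Rrising (1 / 2) (S n) * (1 / 2 + INR (S n))).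
    rewrite S_INR.
    transitivity (((2 * INR n + 1 + 2) * wallis (S (S (S (2 * n))))) * Rrising (1 / 2) (S n));
      [field | rewrite H; field].
Qed.

Lemma wallis_even (n : nat) :
  wallis (2 * n) * INR (fact n) * (INR n + 1 / 2) = PI / 2 * Rrising (1 / 2) (S n).
Proof.
  induction n as [|n IH].
  - simpl (2 * 0)%nat; rewrite wallis_0; simpl; lra.
  - replace (2 * S n)%nat with (S (S (2 * n))) by lia.
    assert (H := wallis_rec (2 * n)).
    rewrite mult_INR in H; change (INR 2) with 2 in H.
    change (Rrising (1 / 2) (S (S n))) with (Rrising (1 / 2) (S n) * (1 / 2 + INR (S n))).
    rewrite <- Rmult_assoc, <- IH, fact_simpl, mult_INR, !S_INR.
    transitivity (((2 * INR n + 2) * wallis (S (S (2 * n)))) * (1 / 2)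
                    * INR (fact n) * (1 / 2 + (INR n + 1))); [field|].
    rewrite H; field.
Qed.

Definition RGamma_approx (x : R) (n : nat) : R :=
  INR (fact n) * exp (x * ln (INR n)) / Rrising x (S n).

Lemma Gamma_approx_R (x : R) (n : nat) : 0 < x ->
  Gamma_approx (RtoC x) n = RtoC (RGamma_approx x n).
Proof.
  intros Hx; unfold Gamma_approx, RGamma_approx.
  assert (H := Rrising_pos x (S n) Hx).
  rewrite rising_R, <- RtoC_mult, Cexp_R, <- RtoC_mult, <- RtoC_div by lra; easy.
Qed.

Lemma RGamma_lim (x l : R) : 0 < x -> is_lim_seq (RGamma_approx x) l -> RGamma x = l.
Proof.
  intros Hx H.
  change (real (Lim_seq (fun n => Re (Gamma_approx (RtoC x) n))) = l).
  rewrite (Lim_seq_ext _ (RGamma_approx x)).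
  - now rewrite (is_lim_seq_unique _ _ H).
  - intros n; rewrite Gamma_approx_R by easy; easy.
Qed.

Lemma is_lim_seq_INR_div_shift (a : R) : 0 <= a ->
  is_lim_seq (fun n => INR n / (INR n + a)) 1.
Proof.
  intros Ha; apply is_lim_seq_incr_1.
  apply (is_lim_seq_ext (fun n => / (1 + a / INR (S n)))).
  { intros n; assert (H : 0 < INR (S n)) by (apply lt_0_INR; lia); field; lra. }
  replace (Finite 1) with (Rbar_inv (1 + 0)) by (simpl; f_equal; field).
  apply is_lim_seq_inv.
  - apply is_lim_seq_plus'; [apply is_lim_seq_const | apply is_lim_seq_inv_INR].
  - simpl; intros E; inversion E; lra.
Qed.

(** The square of the approximation is squeezed between two multiples of [PI] because the
    Wallis integrals of consecutive indices [2n], [2n + 1], [2n + 2] decrease. *)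
Lemma RGamma_approx_half_lim : is_lim_seq (RGamma_approx (1 / 2)) (sqrt PI).
Proof.
  assert (Hpi := PI_RGT_0).
  assert (Hsqr : forall n, INR (S n) * PI / (INR (S n) + 1) <= RGamma_approx (1 / 2) (S n) ^ 2
            <= INR (S n) * PI / (INR (S n) + 1 / 2)).
  { intros n; set (m := S n).
    assert (Hm : 0 < INR m) by (apply lt_0_INR; lia).
    assert (Hr := Rrising_pos (1 / 2) (S m) ltac:(lra)).
    assert (Hf := INR_fact_lt_0 m).
    unfold RGamma_approx.
    set (q := INR (fact m) / Rrising (1 / 2) (S m)).
    assert (Hq : 0 < q) by now apply Rdiv_lt_0_compat.
    replace (_ ^ 2) with (INR m * q ^ 2).
    2:{ transitivity ((exp (1 / 2 * ln (INR m)) * exp (1 / 2 * ln (INR m))) * q ^ 2).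
        - rewrite <- exp_plus; replace (_ + _) with (ln (INR m)) by field.
          now rewrite exp_ln.
        - unfold q; field; lra. }
    assert (Hodd : wallis (S (2 * m)) = q / 2).
    { unfold q; rewrite <- wallis_odd; field; lra. }
    assert (Heven : wallis (2 * m) = PI / 2 / (q * (INR m + 1 / 2))).
    { unfold q; apply (Rmult_eq_reg_r (INR (fact m) * (INR m + 1 / 2))); [|nra].
      rewrite <- Rmult_assoc, wallis_even; field; lra. }
    assert (Hrec := wallis_rec (2 * m)).
    rewrite mult_INR in Hrec; change (INR 2) with 2 in Hrec.
    assert (H1 := wallis_decr (2 * m)).
    assert (H2 := wallis_decr (S (2 * m))).
    assert (Heven' : wallis (S (S (2 * m))) = PI / 2 / (q * (INR m + 1))).
    { apply (Rmult_eq_reg_l (2 * INR m + 2)); [|lra].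
      rewrite Hrec, Heven; field; lra. }
    rewrite Hodd in H1, H2; rewrite Heven in H1; rewrite Heven' in H2.
    unfold Rdiv; rewrite !Rmult_assoc; split; apply Rmult_le_compat_l; try lra.
    - apply (Rmult_le_compat_l (2 * q)) in H2; [|lra].
      eapply Rle_trans; [|eapply Rle_trans; [exact H2|]]; right; field; lra.
    - apply (Rmult_le_compat_l (2 * q)) in H1; [|lra].
      eapply Rle_trans; [|eapply Rle_trans; [exact H1|]]; right; field; lra. }
  apply is_lim_seq_incr_1.
  apply (is_lim_seq_ext (fun n => sqrt (RGamma_approx (1 / 2) (S n) ^ 2))).
  { intros n; apply sqrt_pow2; unfold RGamma_approx.
    apply Rdiv_le_0_compat; [|apply Rrising_pos; lra].
    apply Rmult_le_pos; [apply pos_INR | apply Rlt_le, exp_pos]. }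
  apply (is_lim_seq_continuous sqrt); [apply continuity_pt_sqrt; lra|].
  assert (Hlim : forall a, 0 <= a -> is_lim_seq (fun n => INR (S n) * PI / (INR (S n) + a)) PI).
  { intros a Ha.
    apply (is_lim_seq_incr_1 (fun n => INR n * PI / (INR n + a))).
    apply (is_lim_seq_ext (fun n => PI * (INR n / (INR n + a)))).
    - intros n; unfold Rdiv; ring.
    - replace (Finite PI) with (Finite (PI * 1)) by (f_equal; ring).
      apply is_lim_seq_mult'; [apply is_lim_seq_const | now apply is_lim_seq_INR_div_shift]. }
  eapply is_lim_seq_le_le; [exact Hsqr | apply Hlim; lra | apply Hlim; lra].
Qed.

Lemma RGamma_approx_1_lim : is_lim_seq (RGamma_approx 1) 1.
Proof.
  apply is_lim_seq_incr_1.
  apply (is_lim_seq_ext (fun n => INR (S n) / (INR (S n) + 1))).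
  - intros n; unfold RGamma_approx; set (m := S n).
    assert (Hm : 0 < INR m) by (apply lt_0_INR; lia).
    assert (E : forall i, Rrising 1 i = INR (fact i)).
    { induction i as [|i IH]; [easy|].
      simpl Rrising; rewrite IH, fact_simpl, mult_INR, S_INR; ring. }
    rewrite E, fact_simpl, mult_INR, S_INR, Rmult_1_l, exp_ln by easy.
    assert (Hf := INR_fact_lt_0 m); field; lra.
  - apply (is_lim_seq_incr_1 (fun n => INR n / (INR n + 1))).
    apply is_lim_seq_INR_div_shift; lra.
Qed.

Lemma RGamma_approx_succ_lim (x l : R) : 0 < x ->
  is_lim_seq (RGamma_approx x) l -> is_lim_seq (RGamma_approx (x + 1)) (x * l).
Proof.
  intros Hx H; apply is_lim_seq_incr_1.
  assert (Hsh : forall n, x * Rrising (x + 1) n = Rrising x (S n)).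
  { induction n as [|n IH]; [simpl; ring|].
    change (Rrising (x + 1) (S n)) with (Rrising (x + 1) n * (x + 1 + INR n)).
    change (Rrising x (S (S n))) with (Rrising x (S n) * (x + INR (S n))).
    rewrite <- IH, S_INR; ring. }
  apply (is_lim_seq_ext
    (fun n => (x * RGamma_approx x (S n)) * (INR (S n) / (INR (S n) + (x + 1))))).
  - intros n; unfold RGamma_approx; set (m := S n).
    assert (Hm : 0 < INR m) by (apply lt_0_INR; lia).
    replace ((x + 1) * ln (INR m)) with (x * ln (INR m) + ln (INR m)) by ring.
    rewrite exp_plus, exp_ln by easy.
    assert (H1 := Rrising_pos x (S m) Hx).
    replace (Rrising (x + 1) (S m)) with (Rrising x (S m) * (x + INR m + 1) / x).
    + field; repeat split; lra.
    + apply (Rmult_eq_reg_l x); [|lra]; rewrite Hsh.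
      change (Rrising x (S (S m))) with (Rrising x (S m) * (x + INR (S m))).
      rewrite S_INR; field; lra.
  - replace (Finite (x * l)) with (Finite ((x * l) * 1)) by (f_equal; ring).
    apply is_lim_seq_mult'.
    + apply is_lim_seq_mult'; [apply is_lim_seq_const|].
      now apply -> is_lim_seq_incr_1.
    + apply (is_lim_seq_incr_1 (fun n => INR n / (INR n + (x + 1)))).
      apply is_lim_seq_INR_div_shift; lra.
Qed.

(** The ratio of gamma values in the bound is, up to the factor [2 k + 1], the integral
    that bounds the remainder: both obey the recurrence of Wallis. *)
Lemma RGamma_ratio (k : nat) :
  sqrt PI * RGamma (INR (S k) + 1 / 2) / RGamma (INR (S k))
  = INR (2 * k + 1) * inv_pow_integral k.
Proof.
  assert (Hpi := PI_RGT_0).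
  assert (H : exists a b : R, is_lim_seq (RGamma_approx (INR (S k) + 1 / 2)) a
    /\ is_lim_seq (RGamma_approx (INR (S k))) b /\ b <> 0
    /\ sqrt PI * a = b * (INR (2 * k + 1) * inv_pow_integral k)).
  { induction k as [|k (a & b & Ha & Hb & Hb0 & E)].
    - exists (1 / 2 * sqrt PI), 1; repeat split.
      + simpl INR; rewrite Rplus_comm.
        apply RGamma_approx_succ_lim; [lra | apply RGamma_approx_half_lim].
      + apply RGamma_approx_1_lim.
      + apply R1_neq_R0.
      + simpl; rewrite <- (sqrt_sqrt PI) at 3 by lra; field.
    - exists ((INR (S k) + 1 / 2) * a), (INR (S k) * b).
      assert (HK : 0 < INR (S k)) by (apply lt_0_INR; lia).
      rewrite (S_INR (S k)); repeat split.
      + replace (INR (S k) + 1 + 1 / 2) with (INR (S k) + 1 / 2 + 1) by ring.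
        apply RGamma_approx_succ_lim; [lra|easy].
      + now apply RGamma_approx_succ_lim.
      + apply Rmult_integral_contrapositive; split; [lra | easy].
      + change (inv_pow_integral (S k)) with
          ((2 * INR (S k) - 1) / (2 * INR (S k)) * inv_pow_integral k).
        replace (sqrt PI * ((INR (S k) + 1 / 2) * a))
          with ((INR (S k) + 1 / 2) * (sqrt PI * a)) by ring.
        rewrite E, !plus_INR, !mult_INR, !S_INR.
        change (INR 0) with 0; assert (HK' := pos_INR k); field; lra. }
  destruct H as (a & b & Ha & Hb & Hb0 & E).
  assert (HK : 0 < INR (S k)) by (apply lt_0_INR; lia).
  rewrite (RGamma_lim (INR (S k) + 1 / 2) a ltac:(lra) Ha), (RGamma_lim _ b HK Hb), E.
  field; easy.
Qed.

(** * Stirling's formula for the Euler-Gauss product *)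

Fixpoint log_rising (w : C) (n : nat) : C :=
  match n with
  | O => 0
  | S j => (log_rising w j + Clog (w + RtoC (INR j)))%C
  end.

(** The logarithm of [Gamma_approx] obtained by adding up principal logarithms. It is real
    for real [w] and continuous in [w], which singles out [ln Gamma] among the logarithms
    of the limit. *)
Definition lnGamma_approx (w : C) (n : nat) : C :=
  (RtoC (ln (INR (fact n))) + w * RtoC (ln (INR n)) - log_rising w (S n))%C.

Lemma Cexp_neq_0 (a : C) : Cexp a <> 0.
Proof.
  intros E.
  assert (H : (Cexp a * Cexp (- a))%C = 1).
  { rewrite <- Cexp_plus, Cplus_opp_r; apply Cexp_0. }
  rewrite E, Cmult_0_l in H; now apply C1_nz.
Qed.

Lemma Cexp_minus (a b : C) : Cexp (a - b) = (Cexp a / Cexp b)%C.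
Proof.
  assert (H : (Cexp (a - b) * Cexp b)%C = Cexp a).
  { rewrite <- Cexp_plus; f_equal; ring. }
  rewrite <- H; field; apply Cexp_neq_0.
Qed.

Lemma Cexp_log_rising (w : C) (n : nat) : 0 < Re w -> Cexp (log_rising w n) = rising w n.
Proof.
  intros Hw; induction n as [|n IH]; [apply Cexp_0|].
  simpl log_rising; rewrite Cexp_plus, IH, Cexp_Clog; [easy|].
  intros E; apply (f_equal Re) in E; unfold Re in *; simpl in E.
  assert (H := pos_INR n); lra.
Qed.

Lemma Cexp_lnGamma_approx (w : C) (n : nat) : 0 < Re w ->
  Cexp (lnGamma_approx w n) = Gamma_approx w n.
Proof.
  intros Hw; unfold lnGamma_approx.
  rewrite Cexp_minus, Cexp_plus, Cexp_R, exp_ln by apply INR_fact_lt_0.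
  now rewrite Cexp_log_rising.
Qed.

Lemma is_Clim_seq_Cexp (s : nat -> C) (l : C) :
  is_Clim_seq s l -> is_Clim_seq (fun n => Cexp (s n)) (Cexp l).
Proof.
  intros [H1 H2].
  assert (He : is_lim_seq (fun n => exp (Re (s n))) (exp (Re l))).
  { apply (is_lim_seq_continuous exp); [|easy].
    apply derivable_continuous_pt, derivable_pt_exp. }
  split; simpl; (apply is_lim_seq_mult'; [exact He|]).
  - apply (is_lim_seq_continuous cos); [apply continuity_cos | easy].
  - apply (is_lim_seq_continuous sin); [apply continuity_sin | easy].
Qed.

Lemma Gamma_Cexp (w l : C) : 0 < Re w ->
  is_Clim_seq (lnGamma_approx w) l -> Gamma w = Cexp l.
Proof.
  intros Hw H; apply is_Clim_seq_Cexp in H.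
  apply (is_Clim_seq_ext _ (Gamma_approx w)) in H;
    [|intros n; now apply Cexp_lnGamma_approx].
  destruct H as [H1 H2].
  unfold Gamma; rewrite (is_lim_seq_unique _ _ H1), (is_lim_seq_unique _ _ H2).
  now destruct (Cexp l).
Qed.

Lemma stirling_error_eq (k : nat) (z : C) (n : nat) :
  stirling_error k z n = (log_rising (z + RtoC (1 / 2)) n
    - (stirling_main (S k) (z + RtoC (INR n)) - stirling_main (S k) z))%C.
Proof.
  induction n as [|n IH].
  - cbn [stirling_error log_rising INR]; rewrite Cplus_0_r; ring.
  - cbn [stirling_error log_rising]; rewrite IH.
    replace (z + RtoC (1 / 2) + RtoC (INR n))%C with (z + RtoC (INR n + 1 / 2))%C
      by (rewrite RtoC_plus; ring).
    ring.
Qed.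

Lemma Re_ray_ge (a : C) (m t : R) : 0 <= Re a -> 0 < m -> 0 <= t ->
  m <= Re (RtoC m + RtoC t * a)%C.
Proof.
  intros Ha Hm Ht; unfold Re in *; simpl.
  assert (0 <= t * fst a) by now apply Rmult_le_pos.
  lra.
Qed.

Lemma is_Cderive_ray (a b : C) (t : R) : is_Cderive (fun t => (b + RtoC t * a)%C) t a.
Proof.
  eapply is_Cderive_eq.
  - apply is_Cderive_plus; [apply is_Cderive_const|].
    apply is_Cderive_mult; [|apply is_Cderive_const].
    apply (is_Cderive_R (fun t => t)), (is_derive_id (K := R_AbsRing)).
  - cbv beta; unfold one; simpl; ring.
Qed.

Lemma is_Cderive_Clog_ray (a b : C) (t : R) : 0 < Re (b + RtoC t * a)%C ->
  is_Cderive (fun t => Clog (b + RtoC t * a)) t (a / (b + RtoC t * a))%C.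
Proof.
  intros H; apply (is_Cderive_Clog (fun t => (b + RtoC t * a)%C)).
  - apply is_Cderive_ray.
  - assert (H0 := Cmod_ge_0 (b + RtoC t * a)%C); lra.
Qed.

Lemma Cmod_ray_inv_le (a b : C) (m : R) : 0 < m -> m <= Re b ->
  Cmod (a / b)%C <= Cmod a / m.
Proof.
  intros Hm Hb.
  assert (H := re_le_Cmod b); assert (H0 := Rle_abs (Re b)).
  rewrite Cmod_div by (intros ->; simpl in Hb; lra).
  apply Rmult_le_compat_l; [apply Cmod_ge_0|].
  apply Rinv_le_contravar; lra.
Qed.

Lemma Clog_shift_le (a : C) (m t : R) : 0 <= Re a -> 0 < m -> 0 <= t ->
  Cmod (Clog (RtoC m + RtoC t * a) - RtoC (ln m))%C <= Cmod a / m * t.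
Proof.
  intros Ha Hm Ht.
  assert (H := Cmod_increment_le (fun t => Clog (RtoC m + RtoC t * a))
    (fun t => a / (RtoC m + RtoC t * a))%C (fun t => Cmod a / m * t) (fun _ => Cmod a / m)
    0 t Ht).
  cbv beta in H; rewrite Cmult_0_l, Cplus_0_r, Clog_R, Rmult_0_r, Rminus_0_r in H by easy.
  apply H.
  - intros u Hu; apply is_Cderive_Clog_ray.
    assert (H1 := Re_ray_ge a m u Ha Hm ltac:(lra)); lra.
  - intros u _; auto_derive; [easy|ring].
  - intros u Hu; apply Cmod_ray_inv_le; [easy|]; apply Re_ray_ge; lra.
Qed.

(** The derivative along the segment from [m] to [m + a] of the left-hand side is
    [a * (Clog - ln m)], to which the previous estimate applies. *)
Lemma zlogz_shift_le (a : C) (m : R) : 0 <= Re a -> 0 < m ->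
  Cmod ((RtoC m + a) * (Clog (RtoC m + a) - RtoC (ln m)) - a)%C <= Cmod a * Cmod a / m.
Proof.
  intros Ha Hm.
  assert (H := Cmod_increment_le
    (fun t => (RtoC m + RtoC t * a) * (Clog (RtoC m + RtoC t * a) - RtoC (ln m))
              - (0 + RtoC t * a))%C
    (fun t => a * (Clog (RtoC m + RtoC t * a) - RtoC (ln m)))%C
    (fun t => Cmod a * Cmod a / m * t) (fun _ => Cmod a * Cmod a / m)
    0 1 ltac:(lra)).
  cbv beta in H.
  rewrite Cmult_0_l, Cmult_1_l, !Cplus_0_r, !Cplus_0_l, Clog_R in H by easy.
  replace ((RtoC m + a) * (Clog (RtoC m + a) - RtoC (ln m)) - a)%C with
    ((RtoC m + a) * (Clog (RtoC m + a) - RtoC (ln m)) - a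
     - (RtoC m * (RtoC (ln m) - RtoC (ln m)) - 0))%C by ring.
  rewrite Rmult_0_r, Rminus_0_r, Rmult_1_r in H; apply H.
  - intros t Ht.
    assert (Hre := Re_ray_ge a m t Ha Hm ltac:(lra)).
    eapply is_Cderive_eq.
    + apply is_Cderive_minus; [|apply is_Cderive_ray].
      apply is_Cderive_mult; [apply is_Cderive_ray|].
      apply is_Cderive_minus; [|apply is_Cderive_const].
      apply is_Cderive_Clog_ray; lra.
    + cbv beta; field; intros E; rewrite E in Hre; simpl in Hre; lra.
  - intros t _; auto_derive; [easy|ring].
  - intros t Ht; rewrite Cmod_mult; unfold Rdiv; rewrite Rmult_assoc.
    apply Rmult_le_compat_l; [apply Cmod_ge_0|].
    eapply Rle_trans; [apply Clog_shift_le; lra|].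
    assert (0 <= Cmod a / m) by (apply Rdiv_le_0_compat; [apply Cmod_ge_0 | easy]).
    unfold Rdiv in *; nra.
Qed.

Lemma T_hat_lim (j : nat) (a : C) : (1 <= j)%nat -> 0 <= Re a ->
  is_Clim_seq (fun n => T_hat j (RtoC (INR (S n)) + a)) 0.
Proof.
  intros Hj Ha.
  set (c := RtoC (bernoulli_poly (2 * j) (1 / 2)
                  / (INR (2 * j) * INR (2 * j - 1)))).
  apply (is_Clim_seq_0 _ (fun n => Cmod c / INR (S n))); [|apply is_lim_seq_inv_INR].
  intros n; set (m := INR (S n)).
  assert (Hm : 1 <= m) by (apply (le_INR 1); lia).
  set (w := (RtoC m + a)%C).
  assert (Hw : m <= Cmod w).
  { assert (H := re_le_Cmod w); assert (H0 := Rle_abs (Re w)).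
    assert (E : Re w = m + Re a) by easy; lra. }
  assert (Hw0 : w <> 0) by (apply Cmod_gt_0; lra).
  assert (H1 : INR (2 * j) <> 0) by (apply not_0_INR; lia).
  assert (H2 : INR (2 * j - 1) <> 0) by (apply not_0_INR; lia).
  replace (T_hat j w) with (c / w ^ (2 * j - 1))%C.
  - rewrite Cmod_div, Cmod_pow by now apply Cpow_nz.
    apply Rmult_le_compat_l; [apply Cmod_ge_0|].
    apply Rinv_le_contravar; [lra|].
    eapply Rle_trans; [exact Hw|].
    rewrite <- (pow_1 (Cmod w)) at 1; apply Rle_pow; [lra|lia].
  - unfold c, T_hat.
    rewrite RtoC_div, RtoC_mult by now apply Rmult_integral_contrapositive.
    field; repeat split; try (now apply Cpow_nz); intros E; apply RtoC_inj in E; easy.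
Qed.

(** Far to the right only the leading terms of Stirling's series matter, and these depend
    on the shift [a] through [a * ln n] alone. Hence the sums of logarithms that start at
    different points can be compared with each other. *)
Lemma stirling_main_lim (k : nat) (a : C) : 0 <= Re a ->
  is_Clim_seq (fun n => stirling_main k (RtoC (INR (S n)) + a)
    - ((RtoC (INR (S n)) + a) * RtoC (ln (INR (S n))) - RtoC (INR (S n))))%C 0.
Proof.
  intros Ha.
  apply (is_Clim_seq_ext (fun n =>
    ((RtoC (INR (S n)) + a) * (Clog (RtoC (INR (S n)) + a) - RtoC (ln (INR (S n)))) - a
     + sum_n_m (fun j => T_hat j (RtoC (INR (S n)) + a)) 1 k))%C).
  { intros n; unfold stirling_main; ring. }
  rewrite <- (Cplus_0_r 0); apply is_Clim_seq_plus.
  - apply (is_Clim_seq_0 _ (fun n => Cmod a * Cmod a / INR (S n))).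
    + intros n; apply zlogz_shift_le; [easy|]; apply lt_0_INR; lia.
    + apply is_lim_seq_inv_INR.
  - induction k as [|k IH].
    + apply (is_Clim_seq_ext (fun _ => RtoC 0)); [|apply is_Clim_seq_const].
      intros n; now rewrite sum_n_m_zero by lia.
    + apply (is_Clim_seq_ext (fun n => sum_n_m (fun j => T_hat j (RtoC (INR (S n)) + a)) 1 k
          + T_hat (S k) (RtoC (INR (S n)) + a))%C).
      { intros n; now rewrite Csum_n_Sm by lia. }
      rewrite <- (Cplus_0_r 0); apply is_Clim_seq_plus; [exact IH|].
      apply T_hat_lim; [lia|easy].
Qed.

(** Its limit is the constant of Stirling's formula. *)
Definition ln_fact_defect (n : nat) : R :=
  ln (INR (fact n)) - (INR n + 1 / 2) * ln (INR n) + INR n.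

Lemma log_rising_1 (n : nat) : log_rising 1 n = RtoC (ln (INR (fact n))).
Proof.
  induction n as [|n IH]; [simpl; now rewrite ln_1|].
  assert (Hn : 0 < INR (S n)) by (apply lt_0_INR; lia).
  cbn [log_rising]; rewrite IH, <- RtoC_plus.
  replace (1 + INR n) with (INR (S n)) by (rewrite S_INR; ring).
  rewrite Clog_R, <- RtoC_plus, fact_simpl, mult_INR, ln_mult by
    (try easy; apply INR_fact_lt_0).
  f_equal; ring.
Qed.

(** The factorial is the product of the midpoints that follow [1/2]. *)
Lemma ln_fact_defect_ex_lim : ex_finite_lim_seq ln_fact_defect.
Proof.
  assert (Hhalf : RtoC (1 / 2) <> 0) by (intros E; apply RtoC_inj in E; lra).
  destruct (stirling_error_lim 0 (RtoC (1 / 2))) as (e & He & _); [simpl; lra | easy |].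
  assert (Hm := stirling_main_lim 1 (RtoC (1 / 2)) ltac:(simpl; lra)).
  set (c := stirling_main 1 (RtoC (1 / 2))).
  assert (H : is_Clim_seq (fun n => RtoC (ln_fact_defect (S n))) (e + 0 - c)%C).
  { apply (is_Clim_seq_ext (fun n => stirling_error 0 (RtoC (1 / 2)) (S n)
      + (stirling_main 1 (RtoC (INR (S n)) + RtoC (1 / 2))
         - ((RtoC (INR (S n)) + RtoC (1 / 2)) * RtoC (ln (INR (S n))) - RtoC (INR (S n))))
      - c)%C).
    - intros n; rewrite stirling_error_eq; unfold ln_fact_defect.
      replace (RtoC (1 / 2) + RtoC (1 / 2))%C with (RtoC 1) by (rewrite <- RtoC_plus; f_equal; lra).
      rewrite log_rising_1, (Cplus_comm (RtoC (1 / 2)) (RtoC (INR (S n)))).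
      rewrite !RtoC_plus, RtoC_minus, RtoC_mult, RtoC_plus; unfold c; ring.
    - apply is_Clim_seq_minus; [apply is_Clim_seq_plus|].
      + destruct He as [H1 H2]; split.
        * now apply -> (is_lim_seq_incr_1 (fun n => Re (stirling_error 0 (RtoC (1 / 2)) n))).
        * now apply -> (is_lim_seq_incr_1 (fun n => Im (stirling_error 0 (RtoC (1 / 2)) n))).
      + exact Hm.
      + apply is_Clim_seq_const. }
  exists (Re (e + 0 - c)%C); apply is_lim_seq_incr_1.
  exact (proj1 H).
Qed.

Lemma Rrising_half (n : nat) :
  Rrising (1 / 2) (S n) * 2 ^ S (2 * n) * INR (fact n) = INR (fact (2 * n)) * (2 * INR n + 1).
Proof.
  induction n as [|n IH]; [simpl; lra|].
  replace (2 * S n)%nat with (S (S (2 * n))) by lia.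
  change (Rrising (1 / 2) (S (S n))) with (Rrising (1 / 2) (S n) * (1 / 2 + INR (S n))).
  change (2 ^ S (S (S (2 * n)))) with (2 * (2 * 2 ^ S (2 * n))).
  rewrite (fact_simpl n), (fact_simpl (S (2 * n))), (fact_simpl (2 * n)),
    !mult_INR, !S_INR, mult_INR.
  change (INR 2) with 2.
  transitivity ((Rrising (1 / 2) (S n) * 2 ^ S (2 * n) * INR (fact n))
                * (2 * (2 * INR n + 3) * (INR n + 1))); [field|].
  rewrite IH; ring.
Qed.

(** Wallis' product identifies the constant: the combination [2 a_n - a_2n] of
    [a_n = ln_fact_defect n] has the same limit as [a_n] and is the logarithm of the
    approximation of [Gamma (1 / 2)], up to explicit terms. *)
Lemma ln_fact_defect_lim : is_lim_seq ln_fact_defect (1 / 2 * ln (2 * PI)).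
Proof.
  assert (Hpi := PI_RGT_0).
  destruct ln_fact_defect_ex_lim as [c Hc].
  replace (1 / 2 * ln (2 * PI)) with c; [easy|].
  assert (H1 : is_lim_seq (fun n => 2 * ln_fact_defect (S n) - ln_fact_defect (2 * S n)
             - ln (2 + 1 / INR (S n)) + 1 / 2 * ln 2) (2 * c - c - ln (2 + 0) + 1 / 2 * ln 2)).
  { apply is_lim_seq_plus'; [|apply is_lim_seq_const].
    apply is_lim_seq_minus'; [apply is_lim_seq_minus'|].
    - apply is_lim_seq_mult'; [apply is_lim_seq_const|].
      now apply -> is_lim_seq_incr_1.
    - apply (is_lim_seq_subseq ln_fact_defect c (fun n => (2 * S n)%nat)); [|easy].
      apply eventually_subseq; intros n; lia.
    - apply (is_lim_seq_continuous ln (fun n => 2 + 1 / INR (S n)) (2 + 0)).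
      + apply derivable_continuous_pt; exists (/ (2 + 0)); apply derivable_pt_lim_ln; lra.
      + apply is_lim_seq_plus'; [apply is_lim_seq_const | apply is_lim_seq_inv_INR]. }
  assert (H2 : is_lim_seq (fun n => ln (RGamma_approx (1 / 2) (S n))) (ln (sqrt PI))).
  { apply (is_lim_seq_continuous ln).
    - apply derivable_continuous_pt; exists (/ sqrt PI).
      apply derivable_pt_lim_ln, sqrt_lt_R0; lra.
    - apply -> is_lim_seq_incr_1; apply RGamma_approx_half_lim. }
  assert (E : forall n, 2 * ln_fact_defect (S n) - ln_fact_defect (2 * S n)
             - ln (2 + 1 / INR (S n)) + 1 / 2 * ln 2 = ln (RGamma_approx (1 / 2) (S n))).
  { intros n; set (m := S n).
    assert (Hm : 0 < INR m) by (apply lt_0_INR; lia).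
    assert (Hr := Rrising_pos (1 / 2) (S m) ltac:(lra)).
    assert (Hf := INR_fact_lt_0 m); assert (Hf2 := INR_fact_lt_0 (2 * m)).
    assert (H2m : 0 < 2 ^ S (2 * m)) by (apply pow_lt; lra).
    assert (Hh := f_equal ln (Rrising_half m)).
    rewrite !ln_mult in Hh by first [lra | apply Rmult_lt_0_compat; lra].
    rewrite ln_pow, S_INR, mult_INR in Hh by lra; change (INR 2) with 2 in Hh.
    replace (2 + 1 / INR m) with ((2 * INR m + 1) / INR m) by (field; lra).
    assert (Hx := exp_pos (1 / 2 * ln (INR m))).
    unfold RGamma_approx; rewrite !ln_div by first [lra | apply Rmult_lt_0_compat; lra].
    rewrite (ln_mult (INR (fact m))), ln_exp by lra.
    unfold ln_fact_defect; rewrite mult_INR; change (INR 2) with 2.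
    rewrite (ln_mult 2) by lra; lra. }
  apply (is_lim_seq_ext _ _ _ E) in H1.
  assert (H3 := is_lim_seq_unique _ _ H1); rewrite (is_lim_seq_unique _ _ H2) in H3.
  injection H3 as H3.
  assert (H4 : ln PI = 2 * ln (sqrt PI)).
  { rewrite <- (sqrt_sqrt PI) at 1 by lra.
    assert (0 < sqrt PI) by (apply sqrt_lt_R0; lra).
    rewrite ln_mult by easy; ring. }
  rewrite ln_mult, H4, H3 by lra; rewrite Rplus_0_r; lra.
Qed.

(** Stirling's formula with remainder: [lnGamma_approx] at [n] is [ln_fact_defect n] minus
    the deviation of [stirling_main] from its leading terms, minus the accumulated error,
    plus the value of [stirling_main] at [z]. *)
Lemma lnGamma_approx_lim (k : nat) (z : C) : 0 <= Re z -> z <> 0 ->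
  exists e, Cmod e <= remainder_bound k (Cmod z) /\
    is_Clim_seq (lnGamma_approx (z + RtoC (1 / 2)))
      (RtoC (1 / 2 * ln (2 * PI)) + stirling_main (S k) z - e)%C.
Proof.
  intros Hre Hz.
  destruct (stirling_error_lim k z Hre Hz) as (e & He & Hle).
  exists e; split; [easy|].
  assert (Hm := stirling_main_lim (S k) (z + 1) ltac:(unfold Re in *; simpl; lra)).
  assert (H : is_Clim_seq (fun n => lnGamma_approx (z + RtoC (1 / 2)) (S n))
      (RtoC (1 / 2 * ln (2 * PI)) - 0 - e + stirling_main (S k) z)%C).
  { apply (is_Clim_seq_ext (fun n => RtoC (ln_fact_defect (S n))
      - (stirling_main (S k) (RtoC (INR (S n)) + (z + 1))
         - ((RtoC (INR (S n)) + (z + 1)) * RtoC (ln (INR (S n))) - RtoC (INR (S n))))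
      - stirling_error k z (S (S n)) + stirling_main (S k) z)%C).
    - intros n; rewrite stirling_error_eq; unfold lnGamma_approx, ln_fact_defect.
      rewrite (S_INR (S n)), (RtoC_plus (INR (S n)) 1).
      replace (z + (RtoC (INR (S n)) + 1))%C with (RtoC (INR (S n)) + (z + 1))%C by ring.
      rewrite !RtoC_plus, RtoC_minus, RtoC_mult, RtoC_plus.
      replace (RtoC 1) with (RtoC (1 / 2) + RtoC (1 / 2))%C
        by (rewrite <- RtoC_plus; f_equal; lra).
      ring.
    - apply is_Clim_seq_plus; [apply is_Clim_seq_minus; [apply is_Clim_seq_minus|]|].
      + split; [|apply is_lim_seq_const].
        apply -> (is_lim_seq_incr_1 ln_fact_defect); apply ln_fact_defect_lim.
      + exact Hm.
      + destruct He as [H1 H2]; split.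
        * apply -> (is_lim_seq_incr_1 (fun n => Re (stirling_error k z (S n)))).
          now apply -> (is_lim_seq_incr_1 (fun n => Re (stirling_error k z n))).
        * apply -> (is_lim_seq_incr_1 (fun n => Im (stirling_error k z (S n)))).
          now apply -> (is_lim_seq_incr_1 (fun n => Im (stirling_error k z n))).
      + apply is_Clim_seq_const. }
  replace (RtoC (1 / 2 * ln (2 * PI)) + stirling_main (S k) z - e)%C with
    (RtoC (1 / 2 * ln (2 * PI)) - 0 - e + stirling_main (S k) z)%C by ring.
  destruct H as [H1 H2]; split; now apply is_lim_seq_incr_1.
Qed.

(** * Identification of the branch, and the bound *)

Fixpoint harmonic (n : nat) : R :=
  match n with
  | O => 0
  | S m => harmonic m + / INR (S m)
  end.

Lemma ln_succ_bounds (n : nat) :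
  / INR (S (S n)) <= ln (INR (S (S n))) - ln (INR (S n)) <= / INR (S n).
Proof.
  assert (Hln : forall x, 0 < x -> ln x <= x - 1).
  { intros x Hx; assert (H := exp_ineq1_le (ln x)); rewrite exp_ln in H by easy; lra. }
  assert (Hn : 0 < INR (S n)) by (apply lt_0_INR; lia).
  rewrite (S_INR (S n)).
  set (m := INR (S n)) in *.
  assert (H1 := Hln ((m + 1) / m) ltac:(apply Rdiv_lt_0_compat; lra)).
  assert (H2 := Hln (m / (m + 1)) ltac:(apply Rdiv_lt_0_compat; lra)).
  rewrite ln_div in H1, H2 by lra.
  replace ((m + 1) / m - 1) with (/ m) in H1 by (field; lra).
  replace (m / (m + 1) - 1) with (- / (m + 1)) in H2 by (field; lra).
  lra.
Qed.

Lemma harmonic_ln_bound (n : nat) : Rabs (ln (INR (S n)) - harmonic (S (S n))) <= 2.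
Proof.
  assert (H : harmonic (S (S n)) - ln (INR (S n)) <= 2 /\ ln (INR (S n)) <= harmonic n).
  { induction n as [|n [IH1 IH2]].
    - simpl; rewrite ln_1; lra.
    - assert (H1 := ln_succ_bounds n).
      assert (Hn : 0 < INR (S (S n))) by (apply lt_0_INR; lia).
      change (harmonic (S (S (S n)))) with (harmonic (S (S n)) + / INR (S (S (S n)))).
      split.
      + assert (/ INR (S (S (S n))) <= / INR (S (S n))).
        { apply Rinv_le_contravar; [easy|]; apply le_INR; lia. }
        lra.
      + change (harmonic (S n)) with (harmonic n + / INR (S n)); lra. }
  destruct H as [H1 H2].
  change (harmonic (S (S n))) with (harmonic n + / INR (S n) + / INR (S (S n))) in *.
  assert (0 < / INR (S n)) by (apply Rinv_0_lt_compat, lt_0_INR; lia).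
  assert (0 < / INR (S (S n))) by (apply Rinv_0_lt_compat, lt_0_INR; lia).
  apply Rabs_le; lra.
Qed.

(** The derivative of the summand of index [j] differs from [1 / (j + 1)] by
    [(1 - w) / ((w + j) * (j + 1))], whose sum over [j] is bounded on bounded sets. *)
Lemma log_rising_lipschitz (w w' : C) (Y : R) (n : nat) :
  1 / 2 <= Re w -> 1 / 2 <= Re w' -> Cmod w <= Y -> Cmod w' <= Y ->
  Cmod (log_rising w n - log_rising w' n - (w - w') * RtoC (harmonic n))%C
  <= Cmod (w - w')%C * (4 * (1 + Y)) * (1 - / INR (S n)).
Proof.
  intros Hw Hw' HY HY'.
  set (d := (w - w')%C).
  assert (HY0 : 0 <= Y) by (assert (H := Cmod_ge_0 w); lra).
  induction n as [|n IH].
  - simpl; replace (0 - 0 - d * 0)%C with (RtoC 0) by ring; rewrite Cmod_0; lra.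
  - set (x := INR n).
    assert (Hx : 0 <= x) by apply pos_INR.
    assert (Hstep : Cmod (Clog (w + RtoC x) - Clog (w' + RtoC x) - d * RtoC (/ INR (S n)))%C
      <= Cmod d * (4 * (1 + Y)) * (/ INR (S n) - / INR (S (S n)))).
    { assert (H := Cmod_increment_le
        (fun t => Clog ((w' + RtoC x) + RtoC t * d) - (0 + RtoC t * (d * RtoC (/ INR (S n)))))%C
        (fun t => d / ((w' + RtoC x) + RtoC t * d) - d * RtoC (/ INR (S n)))%C
        (fun t => Cmod d * (4 * (1 + Y)) * (/ INR (S n) - / INR (S (S n))) * t)
        (fun _ => Cmod d * (4 * (1 + Y)) * (/ INR (S n) - / INR (S (S n))))
        0 1 ltac:(lra)).
      cbv beta in H; rewrite !Cmult_0_l, !Cmult_1_l, !Cplus_0_l, Cplus_0_r in H.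
      replace (w' + RtoC x + d)%C with (w + RtoC x)%C in H by (unfold d; ring).
      rewrite Rmult_0_r, Rminus_0_r, Rmult_1_r in H.
      replace (Clog (w + RtoC x) - Clog (w' + RtoC x) - d * RtoC (/ INR (S n)))%C with
        (Clog (w + RtoC x) - d * RtoC (/ INR (S n)) - (Clog (w' + RtoC x) - 0))%C by ring.
      rewrite !S_INR in *; fold x in H; fold x.
      assert (Hre : forall t, 0 <= t <= 1 -> x + 1 / 2 <= Re (w' + RtoC x + RtoC t * d)%C).
      { intros t Ht; unfold d, Re in *; simpl; nra. }
      apply H.
      - intros t Ht; specialize (Hre t Ht).
        apply is_Cderive_minus; [apply is_Cderive_Clog_ray; lra | apply is_Cderive_ray].
      - intros t _; auto_derive; [easy|ring].
      - intros t Ht; specialize (Hre t Ht).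
        set (v := (w' + RtoC t * d)%C).
        replace (w' + RtoC x + RtoC t * d)%C with (v + RtoC x)%C in * by (unfold v; ring).
        assert (Hv : Cmod v <= Y).
        { replace v with (RtoC (1 - t) * w' + RtoC t * w)%C
            by (unfold v, d; rewrite RtoC_minus; ring).
          eapply Rle_trans; [apply Cmod_triangle|].
          rewrite !Cmod_mult, !Cmod_R, !Rabs_right by lra; nra. }
        assert (Hne : (v + RtoC x)%C <> 0).
        { intros E; rewrite E in Hre; simpl in Hre; lra. }
        replace (d / (v + RtoC x) - d * RtoC (/ (x + 1)))%C with
          (d * (1 - v) / ((v + RtoC x) * RtoC (x + 1)))%C.
        2:{ rewrite RtoC_inv by lra; rewrite RtoC_plus; field; split; [|easy].
            rewrite <- RtoC_plus; intros E; apply RtoC_inj in E; lra. }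
        assert (Hx1 : RtoC (x + 1) <> 0) by (intros E; apply RtoC_inj in E; lra).
        rewrite Cmod_div, !Cmod_mult, Cmod_R, (Rabs_right (x + 1))
          by (try lra; now apply Cmult_neq_0).
        assert (H1v : Cmod (1 - v)%C <= 1 + Y).
        { eapply Rle_trans; [apply Cmod_triangle|]; rewrite Cmod_opp, Cmod_1; lra. }
        assert (Hm : x + 1 / 2 <= Cmod (v + RtoC x)%C).
        { assert (Ha := re_le_Cmod (v + RtoC x)%C).
          assert (Hb := Rle_abs (Re (v + RtoC x)%C)); lra. }
        (* As [x + 1 / 2 >= (x + 2) / 4], the bound becomes a telescoping difference. *)
        replace (Cmod d * (4 * (1 + Y)) * (/ (x + 1) - / (x + 1 + 1)))
          with (Cmod d * (1 + Y) * / ((x + 2) / 4 * (x + 1))) by (field; lra).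
        assert (Hd := Cmod_ge_0 d).
        apply Rmult_le_compat.
        + apply Rmult_le_pos; apply Cmod_ge_0.
        + apply Rlt_le, Rinv_0_lt_compat; nra.
        + now apply Rmult_le_compat_l.
        + apply Rinv_le_contravar; [nra|].
          apply Rmult_le_compat_r; lra. }
    cbn [log_rising harmonic]; fold x.
    replace (log_rising w n + Clog (w + RtoC x) - (log_rising w' n + Clog (w' + RtoC x))
             - d * RtoC (harmonic n + / INR (S n)))%C with
      ((log_rising w n - log_rising w' n - d * RtoC (harmonic n))
       + (Clog (w + RtoC x) - Clog (w' + RtoC x) - d * RtoC (/ INR (S n))))%C
      by (rewrite RtoC_plus; ring).
    eapply Rle_trans; [apply Cmod_triangle | lra].
Qed.

(** The harmonic sum is compensated by the term [w * ln n], so the Lipschitz constant does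
    not depend on [n] and passes to the limit. *)
Lemma lnGamma_lim_lipschitz (w w' l l' : C) (Y : R) :
  1 / 2 <= Re w -> 1 / 2 <= Re w' -> Cmod w <= Y -> Cmod w' <= Y ->
  is_Clim_seq (lnGamma_approx w) l -> is_Clim_seq (lnGamma_approx w') l' ->
  Cmod (l - l')%C <= (6 + 4 * Y) * Cmod (w - w')%C.
Proof.
  intros Hw Hw' HY HY' Hl Hl'.
  assert (Hlim := is_Clim_seq_Cmod _ _ (is_Clim_seq_minus _ _ _ _ Hl Hl')).
  apply -> is_lim_seq_incr_1 in Hlim.
  refine (is_lim_seq_le _ _ _ (Finite ((6 + 4 * Y) * Cmod (w - w')%C)) _ Hlim
            (is_lim_seq_const _)).
  intros n; cbv beta.
  assert (H := log_rising_lipschitz w w' Y (S (S n)) Hw Hw' HY HY').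
  assert (Hh := harmonic_ln_bound n).
  replace (lnGamma_approx w (S n) - lnGamma_approx w' (S n))%C with
    ((w - w') * RtoC (ln (INR (S n)) - harmonic (S (S n)))
     - (log_rising w (S (S n)) - log_rising w' (S (S n))
        - (w - w') * RtoC (harmonic (S (S n)))))%C
    by (unfold lnGamma_approx; rewrite RtoC_minus; ring).
  eapply Rle_trans; [apply Cmod_triangle|]; rewrite Cmod_opp, Cmod_mult, Cmod_R.
  assert (Hd := Cmod_ge_0 (w - w')%C).
  assert (HY0 : 0 <= Y) by (assert (H0 := Cmod_ge_0 w); lra).
  assert (0 < / INR (S (S (S n)))) by (apply Rinv_0_lt_compat, lt_0_INR; lia).
  set (D := Cmod (w - w')%C) in *.
  assert (D * Rabs (ln (INR (S n)) - harmonic (S (S n))) <= D * 2)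
    by now apply Rmult_le_compat_l.
  assert (D * (4 * (1 + Y)) * (1 - / INR (S (S (S n)))) <= D * (4 * (1 + Y)) * 1).
  { apply Rmult_le_compat_l; [apply Rmult_le_pos; lra | lra]. }
  lra.
Qed.

Lemma Cexp_eq_inv (a b : C) : Cexp a = Cexp b -> Re a = Re b /\ cos (Im a - Im b) = 1.
Proof.
  intros E.
  assert (H : Cexp (a - b) = 1) by (rewrite Cexp_minus, E; field; apply Cexp_neq_0).
  assert (H1 := f_equal Re H); assert (H2 := f_equal Im H).
  unfold Cexp, Re, Im in *; simpl in *.
  set (x := fst a + - fst b) in *; set (y := snd a + - snd b) in *.
  assert (Hx := exp_pos x).
  assert (Hs : sin y = 0) by (apply Rmult_integral in H2 as [|]; lra).
  assert (Hcs := sin2_cos2 y); unfold Rsqr in Hcs; rewrite Hs in Hcs.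
  assert (Hc : cos y = 1) by nra.
  rewrite Hc, Rmult_1_r in H1.
  split; [|exact Hc].
  rewrite <- exp_0 in H1; apply exp_inv in H1; unfold x in H1; lra.
Qed.

(** The values of [h] are multiples of [2 PI]; if [h 1] were not [0], an intermediate value
    would have another cosine. *)
Lemma cos_eq_1_continuous (h : R -> R) :
  continuity h -> (forall t, cos (h t) = 1) -> h 0 = 0 -> h 1 = 0.
Proof.
  intros Hc Hcos H0.
  enough (Hle : forall g, continuity g -> (forall t, cos (g t) = 1) -> g 0 = 0 -> g 1 <= 0).
  { assert (H1 := Hle h Hc Hcos H0).
    assert (H2 := Hle (fun t => - h t) ltac:(now apply continuity_opp)
      ltac:(intros t; cbv beta; now rewrite cos_neg) ltac:(lra)); cbv beta in H2; lra. }
  clear; intros g Hc Hcos H0.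
  assert (Hpi := PI_RGT_0).
  destruct (Rle_or_lt (g 1) 0) as [|Hpos]; [easy|exfalso].
  destruct (Rle_or_lt PI (g 1)) as [Hge|Hlt].
  - destruct (IVT_gen g 0 1 PI Hc) as [c [_ Ec]].
    { rewrite H0, Rmin_left, Rmax_right by lra; lra. }
    assert (H := Hcos c); rewrite Ec, cos_PI in H; lra.
  - assert (H := cos_decreasing_1 0 (g 1) ltac:(lra) ltac:(lra) ltac:(lra) ltac:(lra) Hpos).
    rewrite Hcos, cos_0 in H; lra.
Qed.

Definition lnGamma_lim (w : C) : C :=
  (real (Lim_seq (fun n => Re (lnGamma_approx w n))),
   real (Lim_seq (fun n => Im (lnGamma_approx w n)))).

Lemma lnGamma_lim_correct (w l : C) :
  is_Clim_seq (lnGamma_approx w) l -> lnGamma_lim w = l.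
Proof.
  intros [H1 H2]; unfold lnGamma_lim.
  rewrite (is_lim_seq_unique _ _ H1), (is_lim_seq_unique _ _ H2).
  now destruct l.
Qed.

Lemma lnGamma_approx_R (x : R) (n : nat) : 0 < x -> Im (lnGamma_approx (RtoC x) n) = 0.
Proof.
  intros Hx.
  assert (E : forall m, Im (log_rising (RtoC x) m) = 0).
  { induction m as [|m IH]; [easy|].
    cbn [log_rising]; rewrite <- RtoC_plus, Clog_R by (assert (H := pos_INR m); lra).
    unfold Im in *; simpl; lra. }
  specialize (E (S n)); unfold lnGamma_approx; unfold Im in *.
  cbn [snd Cminus Cplus Copp Cmult RtoC fst] in *; rewrite E; ring.
Qed.

(** A path from a positive real number at [t = 0] to [z] at [t = 1]. The term
    [(1 - t) ^ 2] keeps it away from [0] even when [z] is purely imaginary. *)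
Definition half_plane_path (z : C) (t : R) : C := (Re z + (1 - t) ^ 2, t * Im z).

Lemma half_plane_path_in (z : C) (t : R) : 0 <= Re z -> z <> 0 ->
  0 <= Re (half_plane_path z t) /\ half_plane_path z t <> 0.
Proof.
  intros Hre Hz; assert (Hsq := pow2_ge_0 (1 - t)).
  split; [simpl; unfold Re in *; simpl; nra|].
  intros E; apply Hz.
  assert (E1 := f_equal Re E); assert (E2 := f_equal Im E).
  unfold half_plane_path in E1, E2; simpl in E1, E2.
  unfold Re, Im in *.
  assert (Ht : t = 1) by nra; subst t.
  apply injective_projections; simpl; nra.
Qed.

Lemma continuous_C_path (f : C -> C) (p : R -> C) (t : R) :
  @ex_derive C_AbsRing C_NormedModule f (p t) ->
  continuous (fun s => Re (p s)) t -> continuous (fun s => Im (p s)) t ->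
  continuous (fun s => Im (f (p s))) t.
Proof.
  intros Hf Hp1 Hp2.
  apply ex_derive_continuous in Hf.
  intros P HP.
  assert (H : locally (T := C_UniformSpace) (p t) (fun w => P (Im (f w)))).
  { apply (proj2 (locally_C _ _)), (Hf (fun c => P (Im c))).
    destruct HP as [eps HP]; exists eps; intros w Hw; apply HP, Hw. }
  destruct H as [eps H].
  change (locally t (fun s => P (Im (f (p s))))).
  apply (filter_imp (fun s => ball (Re (p t)) eps (Re (p s)) /\ ball (Im (p t)) eps (Im (p s)))).
  - intros s Hs; apply H; exact Hs.
  - apply filter_and; [apply Hp1 | apply Hp2]; exists eps; easy.
Qed.

(** Both branches exponentiate to [Gamma]; along the path their difference varies
    continuously in the multiples of [2 i PI], and it vanishes at the real end. *)
Lemma lnGamma_eq_lim (f : C -> C) (z l : C) :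
  is_lnGamma f -> 0 <= Re z -> z <> 0 ->
  is_Clim_seq (lnGamma_approx (z + RtoC (1 / 2))) l -> f (z + RtoC (1 / 2))%C = l.
Proof.
  intros (Hder & Hexp & Hreal) Hre Hz Hl.
  set (w := fun t => (half_plane_path z t + RtoC (1 / 2))%C).
  assert (Hw1 : w 1 = (z + RtoC (1 / 2))%C).
  { unfold w, half_plane_path; apply injective_projections; simpl; unfold Re, Im; ring. }
  assert (Hlim : forall t, is_Clim_seq (lnGamma_approx (w t)) (lnGamma_lim (w t))).
  { intros t; destruct (half_plane_path_in z t Hre Hz) as [H1 H2].
    destruct (lnGamma_approx_lim 0 _ H1 H2) as (e & _ & He).
    unfold w; now rewrite (lnGamma_lim_correct _ _ He). }
  assert (Hwre : forall t, 1 / 2 <= Re (w t)).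
  { intros t; destruct (half_plane_path_in z t Hre Hz) as [H1 _].
    unfold w, Re in *; simpl in *; lra. }
  assert (Hcut : forall t, cut_plane (w t)).
  { intros t [H _]; specialize (Hwre t); lra. }
  assert (HE : forall t, Re (f (w t)) = Re (lnGamma_lim (w t))
             /\ cos (Im (f (w t)) - Im (lnGamma_lim (w t))) = 1).
  { intros t; apply Cexp_eq_inv.
    rewrite Hexp by easy; apply Gamma_Cexp; [|easy]; specialize (Hwre t); lra. }
  rewrite <- Hw1 in *.
  rewrite <- (lnGamma_lim_correct _ _ Hl).
  apply injective_projections; [apply HE|].
  apply Rminus_diag_uniq.
  apply (cos_eq_1_continuous (fun t => Im (f (w t)) - Im (lnGamma_lim (w t)))).
  - intros t; apply (continuity_pt_minus (fun t => Im (f (w t)))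
      (fun t => Im (lnGamma_lim (w t)))).
    + apply continuity_pt_filterlim, continuous_C_path; [now apply Hder| |].
      * apply (ex_derive_continuous (fun s => Re (w s))); unfold w, half_plane_path.
        simpl; auto_derive; easy.
      * apply (ex_derive_continuous (fun s => Im (w s))); unfold w, half_plane_path.
        simpl; auto_derive; easy.
    + (* [K] bounds the speed of the path at distance at most one from [t]. *)
      set (K := 2 * Rabs t + 3 + Rabs (Im z)).
      assert (HK : 0 < K).
      { assert (H1 := Rabs_pos t); assert (H2 := Rabs_pos (Im z)); unfold K; lra. }
      set (Y := Cmod (w t) + K).
      assert (HY : 0 < 6 + 4 * Y).
      { assert (H := Cmod_ge_0 (w t)); unfold Y; lra. }
      assert (Hdist : forall s, Rabs (s - t) < 1 -> Cmod (w s - w t)%C <= Rabs (s - t) * K).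
      { intros s Hs.
        replace (w s - w t)%C with (RtoC (s - t) * (RtoC (s + t - 2) + Ci * RtoC (Im z)))%C.
        2:{ unfold w, half_plane_path; apply injective_projections; simpl;
              unfold Re, Im; ring. }
        rewrite Cmod_mult, Cmod_R; apply Rmult_le_compat_l; [apply Rabs_pos|].
        eapply Rle_trans; [apply Cmod_triangle|].
        rewrite Cmod_mult, Cmod_Ci, !Cmod_R, Rmult_1_l; unfold K.
        assert (Rabs (s + t - 2) <= 2 * Rabs t + 3); [|lra].
        apply Rabs_le; assert (H1 := Rle_abs t); assert (H2 := Rle_abs (- t)).
        rewrite Rabs_Ropp in H2; apply Rabs_lt_between in Hs; lra. }
      intros eps Heps.
      set (M := (6 + 4 * Y) * K).
      assert (HM : 0 < M) by now apply Rmult_lt_0_compat.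
      exists (Rmin 1 (eps / M)); split.
      { apply Rmin_glb_lt; [lra | now apply Rdiv_lt_0_compat]. }
      intros s [_ Hs]; unfold dist in *; simpl in *; unfold R_dist in *.
      assert (Hs1 := Rlt_le_trans _ _ _ Hs (Rmin_l _ _)).
      assert (Hs2 := Rlt_le_trans _ _ _ Hs (Rmin_r _ _)).
      specialize (Hdist s Hs1).
      assert (HYs : Cmod (w s) <= Y).
      { replace (w s) with (w t + (w s - w t))%C by ring.
        eapply Rle_trans; [apply Cmod_triangle|]; unfold Y; nra. }
      assert (Hlip := lnGamma_lim_lipschitz (w s) (w t) _ _ Y (Hwre s) (Hwre t) HYs
        ltac:(unfold Y; lra) (Hlim s) (Hlim t)).
      assert (Him := im_le_Cmod (lnGamma_lim (w s) - lnGamma_lim (w t))%C).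
      unfold Im in Him at 1; simpl in Him.
      apply Rlt_div_r in Hs2; [|easy].
      assert ((6 + 4 * Y) * Cmod (w s - w t)%C <= (6 + 4 * Y) * (Rabs (s - t) * K))
        by (apply Rmult_le_compat_l; lra).
      unfold Im, Rminus in *; unfold M in Hs2; lra.
  - intros t; apply HE.
  - assert (Hw0 : w 0 = RtoC (Re z + 1 + 1 / 2)).
    { unfold w, half_plane_path; apply injective_projections; simpl; ring. }
    assert (Hpos : 0 < Re z + 1 + 1 / 2) by lra.
    rewrite Hw0, Hreal by easy.
    unfold lnGamma_lim, Im at 2; simpl snd.
    rewrite (Lim_seq_ext _ (fun _ => 0)), Lim_seq_const; [simpl; ring|].
    intros n; now apply lnGamma_approx_R.
Qed.

Theorem theorem3 (lnGamma : C -> C) (HlnGamma : is_lnGamma lnGamma)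
  (k : nat) (Hk : (1 <= k)%nat) (z : C) (HRe : (0 <= Re z)%R) (Hz : z <> RtoC 0) :
  (Cmod (R_hat lnGamma (k + 1) z / T_hat k z)%C
   <= eta k * (sqrt PI * RGamma (INR k + 1 / 2) / RGamma (INR k)))%R.
Proof.
  destruct k as [|k]; [lia|clear Hk].
  assert (Hr := proj1 (Cmod_gt_0 z) Hz).
  destruct (lnGamma_approx_lim k z HRe Hz) as (e & Hle & Hlim).
  assert (HR : R_hat lnGamma (S k + 1) z = (- e)%C).
  { unfold R_hat; rewrite (lnGamma_eq_lim _ _ _ HlnGamma HRe Hz Hlim).
    replace (S k + 1 - 1)%nat with (S k) by lia; unfold stirling_main; ring. }
  rewrite HR, RGamma_ratio.
  unfold remainder_bound in Hle.
  set (N := (2 * S k)%nat) in *.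
  set (b := Rabs (bernoulli_poly N 0)) in *.
  assert (HN : 1 < INR N) by (apply (lt_INR 1); unfold N; lia).
  assert (HN1 : INR (N - 1) = INR N - 1) by (rewrite minus_INR by (unfold N; lia); easy).
  replace (2 * k + 1)%nat with (N - 1)%nat by (unfold N; lia).
  replace (S (2 * k)) with (N - 1)%nat in Hle by (unfold N; lia).
  assert (Hpow : 4 <= 2 ^ N).
  { replace 4 with (2 ^ 2) by ring; apply Rle_pow; [lra | unfold N; lia]. }
  assert (Heta : eta (S k) = 1 / (1 - 2 / 2 ^ N)).
  { unfold eta; do 2 f_equal.
    replace (1 - 2 * Z.of_nat (S k))%Z with (1 + - Z.of_nat N)%Z by (unfold N; lia).
    rewrite powerRZ_add by lra.
    rewrite powerRZ_neg', <- pow_powerRZ, powerRZ_1; easy. }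
  assert (Hhalf : Rabs (bernoulli_poly N (1 / 2)) = (1 - 2 / 2 ^ N) * b).
  { replace (bernoulli_poly N (1 / 2)) with (- ((1 - 2 / 2 ^ N) * bernoulli_poly N 0)).
    - rewrite Rabs_Ropp, Rabs_mult, Rabs_right; [easy|].
      apply Rle_ge; assert (2 / 2 ^ N <= 1); [|lra].
      apply Rle_div_l; lra.
    - apply (Rmult_eq_reg_l (2 ^ N)); [|lra].
      rewrite bernoulli_poly_half; field; lra. }
  assert (Hq : 0 < 1 - 2 / 2 ^ N).
  { assert (2 / 2 ^ N <= 1 / 2); [|lra]; apply Rle_div_l; lra. }
  assert (HI : 0 < inv_pow_integral k).
  { clear; induction k as [|k IH]; [assert (H := PI_RGT_0); simpl; lra|].
    change (0 < (2 * INR (S k) - 1) / (2 * INR (S k)) * inv_pow_integral k).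
    assert (1 <= INR (S k)) by (apply (le_INR 1); lia).
    apply Rmult_lt_0_compat; [apply Rdiv_lt_0_compat; lra | easy]. }
  assert (Hrp : 0 < Cmod z ^ (N - 1)) by now apply pow_lt.
  rewrite Heta, HN1.
  (* If the Bernoulli number were zero, so would be the remainder. *)
  destruct (Req_dec b 0) as [Hb|Hb].
  - rewrite Hb in Hle.
    replace e with (RtoC 0).
    + replace (- 0 / T_hat (S k) z)%C with (RtoC 0) by (unfold Cdiv; ring).
      rewrite Cmod_0; apply Rmult_le_pos.
      * apply Rdiv_le_0_compat; lra.
      * apply Rmult_le_pos; lra.
    + symmetry; apply Cmod_eq_0; apply Rle_antisym; [|apply Cmod_ge_0].
      eapply Rle_trans; [exact Hle|]; right; field; lra.
  - assert (Hb0 : 0 < b) by (assert (H := Rabs_pos (bernoulli_poly N 0)); fold b in H; lra).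
    assert (HT : Cmod (T_hat (S k) z)
                 = (1 - 2 / 2 ^ N) * b / (INR N * (INR N - 1) * Cmod z ^ (N - 1))).
    { unfold T_hat; fold N.
      assert (H1 : RtoC (INR N) <> 0) by (intros E; apply RtoC_inj in E; lra).
      assert (H2 : RtoC (INR (N - 1)) <> 0) by (intros E; apply RtoC_inj in E; lra).
      rewrite Cmod_div, !Cmod_mult, Cmod_pow, !Cmod_R, Hhalf, HN1, !Rabs_right
        by (try lra; repeat apply Cmult_neq_0; try easy; now apply Cpow_nz).
      easy. }
    assert (HT0 : 0 < Cmod (T_hat (S k) z)).
    { rewrite HT; apply Rdiv_lt_0_compat; repeat apply Rmult_lt_0_compat; lra. }
    rewrite Cmod_div, Cmod_opp by now apply Cmod_gt_0.
    apply Rle_div_l; [easy|].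
    eapply Rle_trans; [exact Hle|]; rewrite HT; right; field; lra.
Qed.
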